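(* Let $\varphi$ be a crystalline anisotropy on $\mathbb{R}^2$, let $\alpha>0$, and let $\{\Gamma(t)\}_{t\ge0}$ be the unique crystalline elastic flow, with possibly finitely many restarts, starting from a closed admissible polygonal curve $\Gamma(0)$. Assume that there exists $T>0$ such that, writing $\Gamma(t)=\bigcup_{i=1}^nS_i(t)$ for $t\ge T$, $$\inf_{t\in[T,T+m]}\ \min_{1\le i\le n}\mathcal{H}^1(S_i(t))>0\ \text{ for any } m>0\qquad\text{and}\qquad\liminf_{t\to+\infty}\ \min_{1\le i\le n}\mathcal{H}^1(S_i(t))=0.$$ Then there exists a closed admissible polygonal curve $\Gamma^\infty$ such that $\Gamma(t)$ Kuratowski converges to $\Gamma^\infty$ as $t\to+\infty$. Moreover, $\Gamma^\infty$ is represented as a union of (possibly degenerate, i.e. zero-length) segments $\{S_i^\infty\}_{i=1}^n$ such that, for every $i=1,\dots,n$, $S_i(t)$ Kuratowski converges to $S_i^\infty$ and $\mathcal{H}^1(S_i(t))\to\mathcal{H}^1(S_i^\infty)$ as $t\to+\infty$. Furthermore, $S_i^\infty$ is degenerate only if $c_i=0$, and if $\{\theta_i\}$ is the set of angles of $\Gamma(T)$, then $$c_i\mathcal{H}^1(F_i)+\alpha\Big(\frac{c_{i-1}^2\delta_{i-1}}{\mathcal{H}^1(S_{i-1}^\infty)^2\sin\theta_i}+\frac{c_i^2\delta_i[\cot\theta_i+\cot\theta_{i+1}]}{\mathcal{H}^1(S_i^\infty)^2}+\frac{c_{i+1}^2\delta_{i+1}}{\mathcal{H}^1(S_{i+1}^\infty)^2\sin\theta_{i+1}}\Big)=0$$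 for any nondegenerate segment $S_i^\infty$ (terms with $c_j=0$ being $0$).
   Context: Anisotropy. An anisotropy is a convex, positively one-homogeneous function $\varphi:\mathbb{R}^2\to[0,\infty)$ with $c|x|\le\varphi(x)\le C|x|$ for some $0<c\le C<\infty$; $W^\varphi=\{\varphi\le1\}$ and $\varphi^o(x)=\max_{y\in W^\varphi}\langle x,y\rangle$. It is crystalline if $W^\varphi$ is a polygon, whose edges are called facets; $\nu_F$ is the outward unit normal of the facet $F$. $\mathcal{H}^1$ is length. Polygonal curves. All curves are oriented and may self-intersect. A closed polygonal curve is a closed consecutive union $\Gamma=\bigcup_{i=1}^nS_i$ of finitely many segments of positive length, indices being cyclic ($S_0=S_n$, $S_{n+1}=S_1$, likewise for all indexed quantities); consecutive segments are not parallel. $\nu_{S_i}$ is the unit tangent (in the direction of the parametrization) rotated counterclockwise by $90^\circ$. The angle $\theta_i$ between $S_{i-1}$ and $S_i$ is taken in $(0,\pi)$ if $S_{i-1},S_i$ form a convex cone for which $\nu_{S_{i-1}},\nu_{S_i}$ are inner normals, and in $(\pi,2\pi)$ otherwise (for a convex polygon with outward normals, $\theta_i$ is $2\pi$ minus the interior angle). Admissibility. $\Gamma$ is admissible if (for a suitable orientation) each $\nu_{S_i}$ equals $\nu_{F_i}$ for a (unique) facet $F_i$ of $W^\varphi$, and for consecutive $S_{i-1},S_i$ the facets $F_{i-1},F_i$ have a common vertex. The transition number $c_i$ of $S_i$ is $+1$ if $\theta_i,\theta_{i+1}\in(\pi,2\pi)$, $-1$ if $\theta_i,\theta_{i+1}\in(0,\pi)$,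 and $0$ otherwise. The $\varphi$-curvature on $S_i$ is $c_i\mathcal{H}^1(F_i)/\mathcal{H}^1(S_i)$. Set $\delta_j=\mathcal{H}^1(F_j)^2\varphi^o(\nu_{S_j})$. In the theorem, $c_i$, $F_i$, $\delta_i$ are those of the segments $S_i(t)$, $t\ge T$ (they do not depend on $t\ge T$). Parallel curves. $\bar\Gamma=\bigcup_{i=1}^n\bar S_i$ is parallel to $\Gamma=\bigcup_{i=1}^nS_i$ if each $\bar S_i$ is a nondegenerate segment parallel to $S_i$ with $\nu_{\bar S_i}=\nu_{S_i}$. For parallel segments $S,T$ on lines $\ell_S,\ell_T$, $H(S,T)$ is the vector orthogonal to them with $\ell_T=\ell_S+H(S,T)$. Flow. A family $\{\Gamma(t)\}_{t\in[0,T)}$ is a crystalline elastic flow starting from $\Gamma^0=\bigcup_{i=1}^nS_i^0$ if $\Gamma(t)=\bigcup_{i=1}^nS_i(t)$ is parallel to $\Gamma^0$ for all $t$, and $h_i(t)=\langle H(S_i^0,S_i(t)),\nu_{S_i^0}\rangle$ belong to $C^0([0,T))\cap C^1(0,T)$, $h_i(0)=0$, and for each $i$ $$\frac{h_i'}{\varphi^o(\nu_{S_i})}=-\frac{c_i\mathcal{H}^1(F_i)}{\mathcal{H}^1(S_i)}-\frac{\alpha}{\mathcal{H}^1(S_i)}\Big(\frac{c_{i-1}^2\delta_{i-1}}{\mathcal{H}^1(S_{i-1})^2\sin\theta_i}+\frac{c_i^2\delta_i[\cot\theta_i+\cot\theta_{i+1}]}{\mathcal{H}^1(S_i)^2}+\frac{c_{i+1}^2\delta_{i+1}}{\mathcal{H}^1(S_{i+1})^2\sin\theta_{i+1}}\Big)$$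 in $(0,T)$, where $S_j=S_j(t)$. Flow with restarts. From every closed admissible polygonal curve there starts a unique flow up to a maximal time; if this time is finite, $\Gamma(t)$ Kuratowski converges there to an admissible polygonal curve (some segments with zero $\varphi$-curvature having vanished), from which (after relabelling its segments) the flow is restarted. This happens only finitely many times, and yields the unique family $\{\Gamma(t)\}_{t\ge0}$, Kuratowski continuous in $[0,+\infty)$, used in the theorem. Kuratowski convergence is that of closed subsets of $\mathbb{R}^2$. *)

(* Defs.v *)
From HB Require Import structures.
From mathcomp Require Import all_boot all_order all_algebra.
From mathcomp Require Import all_classical all_reals all_analysis.

Set Implicit Arguments.
Unset Strict Implicit.
Unset Printing Implicit Defensive.

Import Order.TTheory GRing.Theory Num.Theory.
Import numFieldNormedType.Exports.

Local Open Scope classical_set_scope.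
Local Open Scope ring_scope.

(* The library's norm on 'rV[R]_2 is the max norm; it gives the right topology,
   but lengths and unit vectors need the Euclidean norm [enorm]. *)
Definition dot (R : realType) (x y : 'rV[R]_2) : R := \sum_j x 0 j * y 0 j.

Definition enorm (R : realType) (x : 'rV[R]_2) : R := Num.sqrt (dot x x).

(* Counterclockwise rotation by a right angle: (x0, x1) |-> (- x1, x0). *)
Definition rot90 (R : realType) (x : 'rV[R]_2) : 'rV[R]_2 :=
  \row_(j < 2) (if j == 0 then - x 0 1 else x 0 0).

Definition cot (R : realType) (x : R) : R := cos x / sin x.

Definition convex_hull (R : realType) (s : seq 'rV[R]_2) : set 'rV[R]_2 :=
  [set x | exists l : 'I_(size s) -> R,
     [/\ forall i, 0 <= l i, \sum_i l i = 1 & x = \sum_i l i *: s`_i]].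

(** Oriented segments, given by their starting point and their end point *)

Definition segment (R : realType) : Type := ('rV[R]_2 * 'rV[R]_2)%type.

Definition seg_set (R : realType) (S : segment R) : set 'rV[R]_2 :=
  [set (1 - t) *: S.1 + t *: S.2 | t in `[0, 1]].

Definition seglen (R : realType) (S : segment R) : R := enorm (S.2 - S.1).

Definition degenerate (R : realType) (S : segment R) : Prop := S.1 = S.2.

Definition tangent (R : realType) (S : segment R) : 'rV[R]_2 :=
  (seglen S)^-1 *: (S.2 - S.1).

Definition normal (R : realType) (S : segment R) : 'rV[R]_2 :=
  rot90 (tangent S).

Definition parallel_seg (R : realType) (S S' : segment R) : Prop :=
  dot (normal S) (S'.2 - S'.1) = 0.

(* [hvec S S'] is H(S, S'): for parallel S and S', the vector orthogonal to S
   that translates the line through S onto the line through S'. *)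
Definition hvec (R : realType) (S S' : segment R) : 'rV[R]_2 :=
  dot (S'.1 - S.1) (normal S) *: normal S.

(* The angle between S and S' where S.2 = S'.1.  The convex cone with apex at
   that point is spanned by - tangent S and tangent S'; the boolean test says
   that both normals point into it. *)
Definition seg_angle (R : realType) (S S' : segment R) : R :=
  let u := - tangent S in
  let v := tangent S' in
  if (0 < dot (normal S) v) && (0 < dot (normal S') u)
  then acos (dot u v) else 2 * pi - acos (dot u v).

(** Anisotropies *)

Definition anisotropy (R : realType) (phi : 'rV[R]_2 -> R) : Prop :=
  [/\ convex_function [set: convex_lmodType 'rV[R]_2] phi,
      forall x, 0 <= phi x,
      forall (l : R) x, 0 < l -> phi (l *: x) = l * phi x
    & exists c C : R, [/\ 0 < c, c <= C &
        forall x, c * enorm x <= phi x <= C * enorm x]].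

Definition wulff (R : realType) (phi : 'rV[R]_2 -> R) : set 'rV[R]_2 :=
  [set x | phi x <= 1].

Definition polar (R : realType) (phi : 'rV[R]_2 -> R) (x : 'rV[R]_2) : R :=
  sup [set dot x y | y in wulff phi].

Definition crystalline (R : realType) (phi : 'rV[R]_2 -> R) : Prop :=
  exists s : seq 'rV[R]_2, wulff phi = convex_hull s.

(* An edge of the Wulff shape, i.e. a nondegenerate segment cut out by a
   supporting line.  It is oriented so that [normal F] is its outward normal. *)
Definition facet (R : realType) (phi : 'rV[R]_2 -> R) (F : segment R) : Prop :=
  ~ degenerate F /\
  seg_set F = [set x | wulff phi x /\ dot (normal F) x = polar phi (normal F)].

(* The facet with the same normal as S (unique if there is one). *)
Definition facet_of (R : realType) (phi : 'rV[R]_2 -> R) (S : segment R) :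
    segment R :=
  get [set F | facet phi F /\ normal F = normal S].

Definition common_vertex (R : realType) (F F' : segment R) : Prop :=
  exists v, v \in [:: F.1; F.2] /\ v \in [:: F'.1; F'.2].

(** Closed polygonal curves, given by the cyclic list of their vertices.
    Segments are numbered from 0 and indices are read modulo the number of
    segments. *)

Definition curve (R : realType) : Type := seq 'rV[R]_2.

Definition vtx (R : realType) (G : curve R) (i : nat) : 'rV[R]_2 :=
  G`_(i %% size G).

Definition seg (R : realType) (G : curve R) (i : nat) : segment R :=
  (vtx G i, vtx G i.+1).

(* [prv G i] is i - 1 modulo [size G]. *)
Definition prv (R : realType) (G : curve R) (i : nat) : nat :=
  (i + (size G).-1)%N.

Definition curve_set (R : realType) (G : curve R) : set 'rV[R]_2 :=
  \bigcup_(i in `I_(size G)) seg_set (seg G i).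

Definition closed_polygonal (R : realType) (G : curve R) : Prop :=
  (0 < size G)%N /\
  forall i, (i < size G)%N ->
    ~ degenerate (seg G i) /\ ~ parallel_seg (seg G i) (seg G i.+1).

(* [angle G i] is the angle between the segments i - 1 and i. *)
Definition angle (R : realType) (G : curve R) (i : nat) : R :=
  seg_angle (seg G (prv G i)) (seg G i).

Definition min_seglen (R : realType) (G : curve R) : R :=
  \big[Num.min/seglen (seg G 0)]_(i < size G) seglen (seg G i).

(* Admissible curves are taken with the orientation for which their normals are
   normals of facets. *)
Definition admissible (R : realType) (phi : 'rV[R]_2 -> R) (G : curve R) :
    Prop :=
  [/\ closed_polygonal G,
      forall i, (i < size G)%N ->
        exists F, facet phi F /\ normal F = normal (seg G i)
    & forall i, (i < size G)%N ->
        common_vertex (facet_of phi (seg G (prv G i))) (facet_of phi (seg G i))].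

Definition transition (R : realType) (G : curve R) (i : nat) : R :=
  if (pi < angle G i) && (pi < angle G i.+1) then 1
  else if (angle G i < pi) && (angle G i.+1 < pi) then - 1
  else 0.

Definition facet_len (R : realType) (phi : 'rV[R]_2 -> R) (G : curve R)
    (i : nat) : R :=
  seglen (facet_of phi (seg G i)).

Definition delta (R : realType) (phi : 'rV[R]_2 -> R) (G : curve R)
    (i : nat) : R :=
  facet_len phi G i ^+ 2 * polar phi (normal (seg G i)).

(* The parenthesized expression of the evolution equation: transition numbers,
   facets and angles are those of G, and l j is the length of the segment j.
   Division by zero gives zero, so terms with zero transition number vanish
   even when l j = 0. *)
Definition elastic_term (R : realType) (phi : 'rV[R]_2 -> R) (G : curve R)
    (l : nat -> R) (i : nat) : R :=
  let c := transition G in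
  let d := delta phi G in
  let th := angle G in
  let p := prv G i in
  c p ^+ 2 * d p / (l p ^+ 2 * sin (th i))
  + c i ^+ 2 * d i * (cot (th i) + cot (th i.+1)) / l i ^+ 2
  + c i.+1 ^+ 2 * d i.+1 / (l i.+1 ^+ 2 * sin (th i.+1)).

Definition parallel_curve (R : realType) (G0 G : curve R) : Prop :=
  size G = size G0 /\
  forall i, (i < size G0)%N ->
    [/\ ~ degenerate (seg G i), parallel_seg (seg G0 i) (seg G i)
      & normal (seg G i) = normal (seg G0 i)].

(** The flow *)

Definition height (R : realType) (G0 : curve R) (G : R -> curve R) (i : nat)
    (t : R) : R :=
  dot (hvec (seg G0 i) (seg (G t) i)) (normal (seg G0 i)).

Definition elastic_flow (R : realType) (phi : 'rV[R]_2 -> R) (alpha : R)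
    (G0 : curve R) (T : \bar R) (G : R -> curve R) : Prop :=
  [/\ (0 < T)%E,
      forall t : R, 0 <= t -> (t%:E < T)%E -> parallel_curve G0 (G t)
    & forall i, (i < size G0)%N ->
      let h := height G0 G i in
      [/\ h 0 = 0,
          {within [set t : R | 0 <= t /\ (t%:E < T)%E], continuous h}
        & forall t : R, 0 < t -> (t%:E < T)%E ->
          let l := fun j => seglen (seg (G t) j) in
          [/\ derivable h t 1, {for t, continuous (derive1 h)}
            & derive1 h t / polar phi (normal (seg G0 i))
              = - (transition G0 i * facet_len phi G0 i / l i)
                - alpha / l i * elastic_term phi G0 l i]]].

(* [collapse P Q]: up to the choice of the first vertex, the closed curve Q is
   obtained from P by erasing vertices that lie on the segment joining their
   two neighbours.  This removes degenerate segments and merges consecutive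
   segments with the same direction; the oriented closed path is unchanged. *)
Inductive collapse (R : realType) : curve R -> curve R -> Prop :=
| collapse_refl P : collapse P P
| collapse_rot k P Q : collapse (rot k P) Q -> collapse P Q
| collapse_drop x P Q :
    seg_set (last x P, head x P) x -> collapse P Q -> collapse (x :: P) Q.

(* At its maximal time tau, the flow G starting from G0 converges to P, in which
   some segments with zero curvature have vanished, and the restarted flow
   begins at the relabelled curve G1 (whose admissibility is required in
   [elastic_flow_restarts]). *)
Definition restart (R : realType) (G0 : curve R) (G : R -> curve R) (tau : R)
    (G1 : curve R) : Prop :=
  exists P : curve R,
    [/\ size P = size G0,
        forall i, (i < size P)%N -> vtx (G t) i @[t --> tau^'-] --> vtx P i,
        exists2 i, (i < size P)%N & degenerate (seg P i),
        forall i, (i < size P)%N -> degenerate (seg P i) -> transition G0 i = 0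
      & collapse P G1].

(** Kuratowski convergence along a filter *)

Definition kuratowski_liminf (R : realType) (T : Type) (F : set_system T)
    (A : T -> set 'rV[R]_2) : set 'rV[R]_2 :=
  [set x | forall U, nbhs x U -> \forall t \near F, A t `&` U !=set0].

Definition kuratowski_limsup (R : realType) (T : Type) (F : set_system T)
    (A : T -> set 'rV[R]_2) : set 'rV[R]_2 :=
  [set x | forall U, nbhs x U -> ~ \forall t \near F, A t `&` U = set0].

Definition kuratowski_cvg (R : realType) (T : Type) (F : set_system T)
    (A : T -> set 'rV[R]_2) (L : set 'rV[R]_2) : Prop :=
  kuratowski_liminf F A = L /\ kuratowski_limsup F A = L.

(* The flow for all times t >= 0, with K restarts at tau 1 < ... < tau K. *)
Definition elastic_flow_restarts (R : realType) (phi : 'rV[R]_2 -> R)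
    (alpha : R) (G : R -> curve R) : Prop :=
  (exists (K : nat) (tau : nat -> R),
    [/\ tau 0%N = 0,
        forall k, (k < K)%N -> tau k < tau k.+1,
        forall k, (k <= K)%N ->
          admissible phi (G (tau k)) /\
          elastic_flow phi alpha (G (tau k))
            (if (k < K)%N then (tau k.+1 - tau k)%:E else +oo%E)
            (fun s => G (tau k + s))
      & forall k, (k < K)%N ->
          restart (G (tau k)) G (tau k.+1) (G (tau k.+1))]) /\
  forall s : R, 0 <= s ->
    kuratowski_cvg (within [set t : R | 0 <= t] (nbhs s))
      (fun t => curve_set (G t)) (curve_set (G s)).

(* Main.v *)
(* Write [v_i] for the vertices, [tau_i] for the unit tangents and [h_i] for the
   signed distance of the line through the segment [i] from the origin.  The
   lengths are linear in the [h_i]: [l = - A h], where [A] is the symmetric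
   cyclic tridiagonal matrix with entries [1 / sin theta_i] and
   [cot theta_i + cot theta_(i+1)].  The same formula applied to the Wulff shape
   gives [A (polar nu) = - c H(F)], so the flow is the weighted gradient flow
   [l_i h_i' = - polar_i g_i], [g = grad E], of the energy
   [E = sum polar_i l_i + alpha sum c_j^2 delta_j / l_j], which is convex in [h].

   As [E' = - sum polar_i g_i^2 / l_i] and the lengths are bounded, [inf |g| = 0].
   Hence [g] lies in the row space of the rows of [A] with [c_j <> 0], and strong
   convexity in these [l_j] yields [E(t) - inf E <= C |g(t)|^2].  This
   Polyak-Lojasiewicz inequality makes [|g|] integrable in time, so [h_i]
   converges whenever [l_i] stays away from [0]; moreover the [l_j] with
   [c_j <> 0] converge to positive limits and [g] tends to [0].

   If [c_i = 0] then [tau_(i-1) = tau_(i+1)], because both facets adjoin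
   the facet of the segment [i] at the same vertex; so [l_i] is a function of
   [h_(i-1)] and [h_(i+1)] only.  The limit equations and the closedness of the
   curve exclude [c_i = c_(i+1) = 0], so all the lengths converge.  Closedness of
   the limit provides two consecutive segments of positive limit length, which
   fixes the translation: all the vertices converge.  Erasing both end points of
   the vanished segments gives the limit curve. *)

Require Import Defs.
From mathcomp Require Import all_boot all_order all_algebra.
From mathcomp Require Import all_classical all_reals all_analysis.
From mathcomp Require Import ring lra zify.

Set Implicit Arguments.
Unset Strict Implicit.
Unset Printing Implicit Defensive.

Import Order.TTheory GRing.Theory Num.Theory.
Import numFieldNormedType.Exports.

Local Open Scope classical_set_scope.
Local Open Scope ring_scope.

(** * Functions with a gradient inequality *)

Lemma le_of_derive_le0 (R : realType) (f df : R -> R) (a s t : R) :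
  (forall u, a < u -> is_derive u (1 : R) f (df u)) ->
  (forall u, a < u -> df u <= 0) -> a < s -> s <= t -> f t <= f s.
Proof.
move=> Df df0 as_ st.
have [u||c cst E] := @MVT_segment _ f df _ _ st.
- by rewrite in_itv /= => /andP[su _]; apply: Df; exact: lt_trans su.
- apply: derivable_within_continuous => u; rewrite in_itv /= => /andP[su _].
  by have [] := Df u (lt_le_trans as_ su).
- rewrite -subr_le0 E; move: cst; rewrite in_itv /= => /andP[sc _].
  by rewrite mulr_le0_ge0 ?subr_ge0 // df0 // (lt_le_trans as_).
Qed.

Lemma cvg_pinfty_cauchy (R : realType) (f : R -> R) :
  (forall e : R, 0 < e ->
     exists t, forall s, t <= s -> `|f s - f t| <= e) ->
  cvg (f s @[s --> +oo]).
Proof.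
move=> H; apply/cauchy_cvgP/cauchyP => e e0.
have [t Ht] : exists t, forall s, t <= s -> `|f s - f t| <= e / 2.
  by apply: H; rewrite divr_gt0.
exists (f t); suff: \forall s \near +oo, ball (f t) e (f s) by [].
near=> s; rewrite -ball_normE /= distrC (@le_lt_trans _ _ (e / 2)) //; last lra.
by apply: Ht; near: s; apply: nbhs_pinfty_ge; rewrite num_real.
Unshelve. all: by end_near. Qed.

(** [M] is nonincreasing past [a] and bounded below; once it is within [e] of its infimum, its later
    variation, and hence that of [f], is at most [e]. *)
Lemma cvg_pinfty_of_decreasing_majorant (R : realType) (f M : R -> R) (a : R) :
  (forall s t, a < s -> s <= t -> `|f t - f s| <= M s - M t) ->
  (forall t, a < t -> 0 <= M t) -> cvg (f s @[s --> +oo]).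
Proof.
move=> fM M0; apply: cvg_pinfty_cauchy => e e0.
have hi : has_inf [set M t | t in [set t | a < t]].
  split; first by exists (M (a + 1)), (a + 1) => //=; rewrite ltrDl.
  by exists 0 => _ [t /= at_ <-]; exact: M0.
have [_ [t /= at_ <-] tlt] := inf_adherent e0 hi.
exists t => s ts; apply: le_trans (fM _ _ at_ ts) _.
rewrite lerBlDl (le_trans (ltW tlt)) // lerD2r.
by apply: ge_inf; [case: hi|exists s => //=; exact: lt_le_trans ts].
Qed.

Lemma is_derive_expR_scale (R : realType) (c t : R) :
  is_derive t (1 : R) (fun u => expR (c * u)) (c * expR (c * t)).
Proof.
have Dc : is_derive t (1 : R) (c \*: id) (c *: 1) by exact: is_deriveZ.
rewrite mulrC -[X in _ * X]mulr1 -/(c *: 1).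
exact: (is_derive1_comp (is_derive_expR _) Dc).
Qed.

(* For [t > a] put [M = C exp(c t / 2) e + exp(- c t / 2)].  By AM-GM, [M']
   dominates [|f'|] once [C] is large, so [f] has bounded variation. *)
Lemma cvg_of_gradient_inequality (R : realType) (f df e de G : R -> R)
    (a d C k : R) :
  0 < d -> 0 < C ->
  (forall t, a < t -> is_derive t (1 : R) f (df t)) ->
  (forall t, a < t -> is_derive t (1 : R) e (de t)) ->
  (forall t, a < t -> 0 <= e t) ->
  (forall t, a < t -> de t <= - (d * G t)) ->
  (forall t, a < t -> e t <= C * G t) ->
  (forall t, a < t -> df t ^+ 2 <= k * G t) ->
  cvg (f s @[s --> +oo]).
Proof.
move=> d0 C0 Df De e0 deG eG dfG.
(* The hypotheses give [de t <= - c * e t], so a weight growing at the rate [c / 2] leaves room. [A]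
   makes [4 * (u * w)] below dominate the bound on [df t ^+ 2]. *)
pose c := d / C; pose A := (`|k| + 1) / (d * c).
have c0 : 0 < c by rewrite divr_gt0.
have k1 : 0 < `|k| + 1 by rewrite ltr_wpDl.
have A0 : 0 < A := divr_gt0 k1 (mulr_gt0 d0 c0).
pose x (t : R) : R := expR (c / 2 * t).
pose y (t : R) : R := expR (- (c / 2) * t).
have xy t : x t * y t = 1 by rewrite -expRD mulNr subrr expR0.
pose M t := A * (x t * e t) + y t.
pose dM t := A * (x t * (de t + c / 2 * e t)) - c / 2 * y t.
have DM t : a < t -> is_derive t (1 : R) M (dM t).
  move=> /De Det.
  have Dx : is_derive t (1 : R) x (c / 2 * x t) by exact: is_derive_expR_scale.
  have Dy : is_derive t (1 : R) y (- (c / 2) * y t).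
    exact: is_derive_expR_scale.
  have DA := is_deriveD (is_deriveZ A (is_deriveM Dx Det)) Dy.
  apply: (is_derive_eq DA).
  by rewrite /dM /GRing.scale /=; ring.
have bound t : a < t -> `|df t| <= - dM t.
  move=> at_.
  have G0 : 0 <= G t by have := le_trans (e0 t at_) (eG t at_); rewrite pmulr_rge0.
  have x0 : 0 < x t by exact: expR_gt0.
  have y0 : 0 < y t by exact: expR_gt0.
  (* Half of the dissipation [d * G t] pays for the derivative of the weight; the other half remains
     in [h2]. *)
  have h1 : c / 2 * e t <= d / 2 * G t.
    have -> : d / 2 * G t = c / 2 * (C * G t) by rewrite /c; field; lra.
    by rewrite ler_pM2l ?eG // divr_gt0.
  have h2 : (A * (d / 2) * (x t * G t) + c / 2 * y t) <= - dM t.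
    rewrite /dM opprB -subr_ge0.
    have -> : c / 2 * y t - A * (x t * (de t + c / 2 * e t)) -
      (A * (d / 2) * (x t * G t) + c / 2 * y t) =
      A * (x t * (- de t - d * G t + (d / 2 * G t - c / 2 * e t))) by field.
    apply: mulr_ge0; first exact: ltW.
    apply: mulr_ge0; first exact: ltW.
    have := deG t at_; lra.
  apply: le_trans h2.
  set u := A * (d / 2) * (x t * G t); set w := c / 2 * y t.
  have d2 : 0 <= d / 2 by lra.
  have c2 : 0 <= c / 2 by lra.
  have u0 : 0 <= u.
    by apply: mulr_ge0; apply: mulr_ge0 => //; exact: ltW.
  have w0 : 0 <= w by apply: mulr_ge0 => //; exact: ltW.
  have uw : (`|k| + 1) * G t <= (u + w) ^+ 2.
    have -> : (`|k| + 1) * G t = 4 * (u * w).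
      rewrite /u /w /A; transitivity ((`|k| + 1) * G t * (x t * y t)).
        by rewrite xy mulr1.
      by field; rewrite (gt_eqF c0) (gt_eqF d0).
    by rewrite -subr_ge0 (_ : _ - _ = (u - w) ^+ 2) ?sqr_ge0 //; ring.
  rewrite -(ler_pXn2r (n := 2)) ?nnegrE ?addr_ge0 // real_normK ?num_real //.
  apply: le_trans (dfG t at_) (le_trans _ uw).
  by rewrite ler_wpM2r // (le_trans (ler_norm k)) // lerDl.
apply: (@cvg_pinfty_of_decreasing_majorant _ f M a); last first.
  move=> t at_; rewrite addr_ge0 ?expR_ge0 // mulr_ge0 ?(ltW A0) //.
  by rewrite mulr_ge0 ?expR_ge0 ?e0.
have DB u : a < u -> is_derive u (1 : R) (fun v => M v - f v) (dM u - df u).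
  by move=> au; exact: (is_deriveB (DM u au) (Df u au)).
have DD u : a < u -> is_derive u (1 : R) (fun v => M v + f v) (dM u + df u).
  by move=> au; exact: (is_deriveD (DM u au) (Df u au)).
have dB u : a < u -> dM u - df u <= 0.
  by move=> /bound; rewrite ler_norml => /andP[]; lra.
have dD u : a < u -> dM u + df u <= 0.
  by move=> /bound; rewrite ler_norml => /andP[]; lra.
move=> s t as_ st; have := le_of_derive_le0 DB dB as_ st.
have := le_of_derive_le0 DD dD as_ st.
by rewrite ler_norml opprB => ? ?; apply/andP; split; lra.
Qed.

(** * Gradient flow of the energy *)

(** Cauchy-Schwarz by Lagrange's identity: twice the difference of the sides is the double sum of
    the squares of [x i * y j - x j * y i]. *)
Lemma sqr_sum_le (R : realFieldType) (n : nat) (x y : 'I_n -> R) :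
  (\sum_i x i * y i) ^+ 2 <= (\sum_i x i ^+ 2) * (\sum_i y i ^+ 2).
Proof.
have dbl : (\sum_i x i ^+ 2) * (\sum_i y i ^+ 2) *+ 2 =
    \sum_i \sum_j (x i ^+ 2 * y j ^+ 2 + x j ^+ 2 * y i ^+ 2).
  rewrite mulr2n {2}mulrC !big_distrlr /= -big_split /=; apply: eq_bigr => i _.
  by rewrite -big_split /=; apply: eq_bigr => j _; rewrite [X in _ + X]mulrC.
rewrite -(ler_pMn2r (n := 2)) // dbl expr2 big_distrlr /= -sumrMnl.
apply: ler_sum => i _; rewrite -sumrMnl; apply: ler_sum => j _.
rewrite -subr_ge0 (_ : _ - _ = (x i * y j - x j * y i) ^+ 2) ?sqr_ge0 //; ring.
Qed.

Lemma exists_pos_lb (R : realFieldType) (n : nat) (P : pred 'I_n) (x : 'I_n -> R) :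
  (forall i, P i -> 0 < x i) -> exists2 d, 0 < d & forall i, P i -> d <= x i.
Proof.
move=> x0; exists (\big[Num.min/1]_(i | P i) x i).
  by elim/big_ind: _ => // a b a0 b0; rewrite lt_min a0.
by move=> i Pi; exact: bigmin_le_cond.
Qed.

Lemma sqr_le_sum_sqr (R : realType) (n : nat) (x : 'I_n -> R) (i : 'I_n) :
  x i ^+ 2 <= \sum_j x j ^+ 2.
Proof. by rewrite (bigD1 i) //= lerDl sumr_ge0 // => j _; exact: sqr_ge0. Qed.

(** The tangent to the inverse at [x] has the exact remainder [(y - x) ^+ 2 / (x ^+ 2 * y)];
    bounding the denominator by [L ^+ 3] gives uniform strong convexity. *)
Lemma inv_convexity (R : realFieldType) (x y L : R) : 0 < x -> 0 < y ->
  x <= L -> y <= L ->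
  x^-1 - y^-1 <= (y - x) / x ^+ 2 - (y - x) ^+ 2 / L ^+ 3.
Proof.
move=> x0 y0 xL yL; have L0 : 0 < L := lt_le_trans x0 xL.
have -> : x^-1 - y^-1 = (y - x) / x ^+ 2 - (y - x) ^+ 2 / (x ^+ 2 * y).
  by field; rewrite !gt_eqF.
rewrite lerD2l lerN2 ler_wpM2l ?sqr_ge0 // lef_pV2 ?posrE; last 2 first.
- exact: exprn_gt0.
- by rewrite mulr_gt0 ?exprn_gt0.
rewrite [L ^+ 3]exprSr; apply: ler_pM => //.
- exact: exprn_ge0 (ltW x0).
- exact: ltW.
- by rewrite lerXn2r // nnegrE ltW.
Qed.

Section gradient_flow.
Context (R : realType) (n : nat) (A : 'M[R]_n) (phi b w : 'I_n -> R).
Context (p dp : 'I_n -> R -> R).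

(** In the application [p] holds the heights of the lines, [l] the lengths, and [phi] the polar
    values of the normals. By [A_sym] and [bE], [g] is the gradient of [energy] with respect to
    [p]. *)
Let l i (t : R) := - \sum_j A i j * p j t.
Let g i (t : R) := b i + \sum_j A i j * (w j / l j t ^+ 2).
Let energy (t : R) := \sum_i phi i * l i t + \sum_j w j / l j t.

Hypothesis A_sym : forall i j, A i j = A j i.
Hypothesis phi_gt0 : forall i, 0 < phi i.
Hypothesis w_ge0 : forall i, 0 <= w i.
Hypothesis bE : forall i, b i = - \sum_j A i j * phi j.
Hypothesis l_gt0 : forall i (t : R), 0 <= t -> 0 < l i t.
Hypothesis p_derive : forall i (t : R), 0 < t -> is_derive t (1 : R) (p i) (dp i t).
Hypothesis flow : forall i (t : R), 0 < t -> l i t * dp i t = - (phi i * g i t).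

Lemma phi_ge0 i : 0 <= phi i. Proof. exact: ltW. Qed.

Lemma l_ge0 i (t : R) : 0 <= t -> 0 <= l i t. Proof. by move=> /(l_gt0 i)/ltW. Qed.

Lemma sum_sym (x y : 'I_n -> R) :
  \sum_i x i * (\sum_j A i j * y j) = \sum_i y i * (\sum_j A i j * x j).
Proof.
under eq_bigr do rewrite mulr_sumr.
under [RHS]eq_bigr do rewrite mulr_sumr.
rewrite exchange_big; apply: eq_bigr => i _; apply: eq_bigr => j _.
by rewrite A_sym; ring.
Qed.

Lemma sum_b (x : 'I_n -> R) : \sum_i b i * x i = - \sum_i phi i * (\sum_j A i j * x j).
Proof.
rewrite sum_sym -sumrN; apply: eq_bigr => i _.
by rewrite bE mulNr mulrC.
Qed.

Lemma is_derive_l i (t : R) : 0 < t ->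
  is_derive t (1 : R) (l i) (- \sum_j A i j * dp j t).
Proof.
move=> t0.
have D := @is_derive_sum R R R n (fun j => A i j \*: p j) t 1
  (fun j => A i j *: dp j t)
  (fun j => is_deriveZ (A i j) (p_derive j t0)).
have -> : l i = - (\sum_j (A i j \*: p j)).
  by apply/funext => s; rewrite /l /= fct_sumE.
exact: is_deriveN.
Qed.

Let denergy (t : R) := - \sum_i phi i * g i t ^+ 2 / l i t.

(** The chain rule gives [\sum_i g i t * dp i t], and [flow] turns this into minus the weighted
    square of the gradient. *)
Lemma is_derive_energy (t : R) : 0 < t -> is_derive t (1 : R) energy (denergy t).
Proof.
move=> t0; have t0' := ltW t0.
pose dl i := - \sum_j A i j * dp j t.
have Dl i : is_derive t (1 : R) (l i) (dl i) by exact: is_derive_l.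
have Dw i : is_derive t (1 : R) (fun s => (l i s)^-1) (- (l i t) ^- 2 *: dl i).
  by apply: is_deriveV => //; rewrite gt_eqF // l_gt0.
have D1 := @is_derive_sum R R R n (fun j => phi j \*: l j) t 1
  (fun j => phi j *: dl j) (fun j => is_deriveZ (phi j) (Dl j)).
have D2 := @is_derive_sum R R R n (fun j => w j \*: (fun s => (l j s)^-1)) t 1
  (fun j => w j *: (- (l j t) ^- 2 *: dl j)) (fun j => is_deriveZ (w j) (Dw j)).
have -> : energy = \sum_j (phi j \*: l j) + \sum_j (w j \*: (fun s => (l j s)^-1)).
  by apply/funext => s; rewrite /energy /= -![(_ + _) s]/(_ s + _ s) !fct_sumE.
apply: is_derive_eq (is_deriveD D1 D2) _.
rewrite /GRing.scale /=.
have -> : \sum_i phi i * dl i = \sum_i b i * dp i t.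
  by rewrite sum_b -sumrN; apply: eq_bigr => i _; rewrite /dl mulrN.
have -> : \sum_i w i * (- l i t ^- 2 * dl i) =
    \sum_i dp i t * \sum_j A i j * (w j / l j t ^+ 2).
  by rewrite sum_sym; apply: eq_bigr => i _; rewrite /dl; ring.
rewrite -big_split /= /denergy -sumrN; apply: eq_bigr => i _.
rewrite (mulrC (dp i t)) -mulrDl -/(g i t).
have lt0 : l i t != 0 by rewrite gt_eqF // l_gt0.
by apply: (mulfI lt0); rewrite mulrCA flow //; field.
Qed.

Lemma phi_l_le_energy i (t : R) : 0 <= t -> phi i * l i t <= energy t.
Proof.
move=> t0; rewrite /energy (bigD1 i) //= -addrA lerDl addr_ge0 // sumr_ge0 // => j _.
  by rewrite mulr_ge0 ?phi_ge0 ?l_ge0.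
by rewrite divr_ge0 ?l_ge0.
Qed.

Lemma w_div_l_le_energy i (t : R) : 0 <= t -> w i / l i t <= energy t.
Proof.
move=> t0; rewrite /energy [X in _ + X](bigD1 i) //= addrCA lerDl addr_ge0 // sumr_ge0 // => j _.
  by rewrite mulr_ge0 ?phi_ge0 ?l_ge0.
by rewrite divr_ge0 ?l_ge0.
Qed.

Lemma energy_ge0 (t : R) : 0 <= t -> 0 <= energy t.
Proof.
move=> t0; rewrite addr_ge0 // sumr_ge0 // => j _.
  by rewrite mulr_ge0 ?phi_ge0 ?l_ge0.
by rewrite divr_ge0 ?l_ge0.
Qed.

Lemma denergy_le0 (t : R) : 0 < t -> denergy t <= 0.
Proof.
move=> t0; rewrite oppr_le0 sumr_ge0 // => i _.
by apply: divr_ge0; [apply: mulr_ge0; [exact: phi_ge0|exact: sqr_ge0]|exact/l_ge0/ltW].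
Qed.

Lemma energy_decr (s t : R) : 0 < s -> s <= t -> energy t <= energy s.
Proof. by apply: le_of_derive_le0; [exact: is_derive_energy|exact: denergy_le0]. Qed.

(** The energy dominates each [phi i * l i t] and decreases. The bound starts at time 1 because the
    flow equation is available only at positive times. *)
Lemma l_bounded : exists2 L, 0 < L & forall i (t : R), 1 <= t -> l i t <= L.
Proof.
have [d d0 dphi] := @exists_pos_lb _ _ predT phi (fun i _ => phi_gt0 i).
have e0 := energy_ge0 (@ler01 R).
exists (energy 1 / d + 1); first by rewrite ltr_wpDl // divr_ge0 // ltW.
move=> i t t1; have t0 : 0 <= t := le_trans ler01 t1.
apply: (@le_trans _ _ (energy 1 / d)); last by rewrite lerDl.
rewrite ler_pdivlMr // (le_trans _ (energy_decr ltr01 t1)) //.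
rewrite (le_trans _ (phi_l_le_energy i t0)) // mulrC ler_wpM2r ?dphi //.
by rewrite ltW // l_gt0.
Qed.

(** The bounded energy also dominates [w i / l i t], which would blow up if a length of positive
    weight became small. *)
Lemma l_bounded_below : exists2 d, 0 < d &
  forall i (t : R), w i != 0 -> 1 <= t -> d <= l i t.
Proof.
have e1 : 0 < energy 1 + 1 by rewrite ltr_wpDl // energy_ge0.
have wpos i : w i != 0 -> 0 < w i / (energy 1 + 1).
  by move=> wi; rewrite divr_gt0 // lt_def wi w_ge0.
have [d d0 dw] := exists_pos_lb wpos.
exists d => // i t wi t1; apply: le_trans (dw i wi) _.
have t0 : 0 <= t := le_trans ler01 t1.
have lt0 := l_gt0 i t0.
rewrite ler_pdivrMr // mulrC -ler_pdivrMr //.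
apply: le_trans (w_div_l_le_energy i t0) _.
by apply: le_trans (energy_decr ltr01 t1) _; rewrite lerDl.
Qed.

Let G (t : R) := \sum_i g i t ^+ 2.

Lemma G_ge0 (t : R) : 0 <= G t.
Proof. by apply: sumr_ge0 => i _; exact: sqr_ge0. Qed.

Lemma denergy_le : exists2 d, 0 < d & forall t : R, 1 < t -> denergy t <= - (d * G t).
Proof.
have [L L0 lL] := l_bounded.
have [d d0 dphi] := @exists_pos_lb _ _ predT phi (fun i _ => phi_gt0 i).
exists (d / L); first exact: divr_gt0.
move=> t t1; have t0 : 0 <= t := ltW (lt_trans ltr01 t1).
rewrite lerN2 mulr_sumr; apply: ler_sum => i _.
have lt0 := l_gt0 i t0.
rewrite [X in _ <= X]mulrAC; apply: ler_wpM2r; first exact: sqr_ge0.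
apply: ler_pM; [exact: ltW|by rewrite invr_ge0 ltW|exact: dphi|].
by rewrite lef_pV2 ?posrE // lL // ltW.
Qed.

(** Otherwise the energy would decrease at least at the rate [d * e] forever, although it is
    nonnegative. *)
Lemma G_small (e t0 : R) : 0 < e -> exists2 t, t0 <= t & G t < e.
Proof.
move=> e0; apply: contrapT => nG.
have Ge t : t0 <= t -> e <= G t.
  by move=> tt; rewrite leNgt; apply/negP => Gt; apply: nG; exists t.
have [d d0 dG] := denergy_le.
pose a := Num.max 1 t0.
pose f t := energy t + d * e * t.
have Df t : a < t -> is_derive t (1 : R) f (denergy t + d * e).
  rewrite gt_max => /andP[t1 _].
  have D := is_deriveD (is_derive_energy (lt_trans ltr01 t1))
    (is_deriveZ (d * e) (is_derive_id t (1 : R))).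
  by apply: is_derive_eq D _; rewrite /GRing.scale /= mulr1.
have df0 t : a < t -> denergy t + d * e <= 0.
  rewrite gt_max => /andP[t1 tt].
  have h : d * e <= d * G t by rewrite ler_pM2l // Ge // ltW.
  by have := dG t t1; lra.
(* At this [t] the loss accumulated since [s] would be [energy s + 1]. *)
pose s := a + 1; pose t := s + (energy s + 1) / (d * e).
have de0 : 0 < d * e by exact: mulr_gt0.
have a1 : 1 <= a by rewrite le_max lexx.
have s0 : 0 <= s by rewrite /s; lra.
have as_ : a < s by rewrite /s; lra.
have es := energy_ge0 s0.
have st : s <= t by rewrite lerDl divr_ge0 ?(ltW de0) // addr_ge0.
have := le_of_derive_le0 Df df0 as_ st.
have et := energy_ge0 (le_trans s0 st).
have E : d * e * t = d * e * s + energy s + 1.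
  by rewrite /t; field; rewrite !gt_eqF.
by rewrite /f E; lra.
Qed.


(** * The Polyak-Lojasiewicz inequality and its consequences *)

Let W j := w j != 0.
Let B : 'M[R]_n := \matrix_(i, j) (if W i then A i j else 0).
Let rowb : 'rV[R]_n := \row_i b i.
Let rowg t : 'rV[R]_n := \row_i g i t.

Lemma sum_A_w i (t : R) :
  \sum_j A i j * (w j / l j t ^+ 2) = \sum_j (w j / l j t ^+ 2) * B j i.
Proof.
apply: eq_bigr => j _; rewrite mxE A_sym /W; case: eqP => [->|_] /=; ring.
Qed.

Lemma rowgE (t : R) : rowg t = rowb + (\row_j (w j / l j t ^+ 2)) *m B.
Proof.
apply/rowP => i; rewrite !mxE /g sum_A_w; congr (_ + _).
by apply: eq_bigr => j _; rewrite [in RHS]mxE.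
Qed.

(* Along the flow the gradient has infimum [0], and it differs from [b] by an
   element of the row space of [B], which is closed. *)
Lemma rowb_sub : (rowb <= B)%MS.
Proof.
rewrite submxE; apply/eqP/rowP => k; rewrite [RHS]mxE.
(* Membership in the row space is tested by [cokermx B]. It kills the part of the gradient that
   varies in time, so the test of [b] equals that of the gradient at any time, which can be made
   small. *)
have E (t : R) : (rowb *m cokermx B) 0 k = \sum_i g i t * cokermx B i k.
  have -> : rowb *m cokermx B = rowg t *m cokermx B.
    by rewrite rowgE mulmxDl -mulmxA mulmx_coker mulmx0 addr0.
  by rewrite mxE; apply: eq_bigr => i _; rewrite mxE.
set x := (_ *m _) 0 k in E *; set K := \sum_i cokermx B i k ^+ 2.
have K0 : 0 <= K by apply: sumr_ge0 => i _; exact: sqr_ge0.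
apply/eqP; rewrite -sqrf_eq0 eq_le sqr_ge0 andbT; apply/ler_addgt0Pr => e e0.
have K1 : 0 < K + 1 by lra.
have [t _ Gt] := G_small 0 (divr_gt0 e0 K1).
rewrite add0r (E t); apply: le_trans (sqr_sum_le _ _) _.
rewrite -/K -/(G t); apply: (@le_trans _ _ (e / (K + 1) * (K + 1))).
  by rewrite ler_pM ?G_ge0 // ?(ltW Gt) // lerDl.
by rewrite divfK // gt_eqF.
Qed.

(** A pseudo-inverse of [B] supplies the coefficients [y], bounded by Cauchy-Schwarz. Thus the
    gradient, paired with a displacement of [p], only sees the changes of the lengths with nonzero
    weight. *)
Lemma gradient_in_row_space : exists y : 'I_n -> R -> R, exists2 C, 0 < C &
  (forall t j, y j t ^+ 2 <= C * G t) /\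
  (forall t (x : 'I_n -> R),
     \sum_i g i t * x i = \sum_(j | W j) y j t * \sum_i A j i * x i).
Proof.
pose Q := pinvmx B.
pose C := 1 + \sum_j \sum_i Q i j ^+ 2.
have C0 : 0 <= \sum_j \sum_i Q i j ^+ 2.
  by do 2!(apply: sumr_ge0 => ? _); exact: sqr_ge0.
exists (fun j t => (rowg t *m Q) 0 j), C; first by rewrite /C; lra.
split=> [t j|t x].
  have -> : (rowg t *m Q) 0 j = \sum_i g i t * Q i j.
    by rewrite mxE; apply: eq_bigr => i _; rewrite mxE.
  apply: le_trans (sqr_sum_le _ _) _; rewrite mulrC ler_wpM2r ?G_ge0 //.
  rewrite /C [X in _ <= 1 + X](bigD1 j) //= addrCA lerDl addr_ge0 // sumr_ge0 // => k _.
  by apply: sumr_ge0 => i _; exact: sqr_ge0.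
have sub : (rowg t <= B)%MS.
  by rewrite rowgE addmx_sub ?rowb_sub // submxMl.
have gE i : g i t = \sum_j (rowg t *m Q) 0 j * B j i.
  have := mulmxKpV sub => /rowP/(_ i); rewrite [in RHS]mxE => <-.
  by rewrite mxE.
under eq_bigr do rewrite gE mulr_suml.
rewrite exchange_big /= [RHS]big_mkcond /=; apply: eq_bigr => j _.
case: ifPn => Wj.
  by rewrite mulr_sumr; apply: eq_bigr => i _; rewrite !mxE Wj mulrA.
by apply: big1 => i _; rewrite !mxE (negbTE Wj); ring.
Qed.

(** Strong convexity bounds the gap by minus the gradient paired with the displacement, less a
    quadratic term in the weighted lengths. By [gradient_in_row_space] the pairing involves the same
    lengths, so Young's inequality absorbs it at the cost of half the quadratic term. *)
Lemma energy_gap : exists2 C, 0 < C & exists2 k, 0 < k &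
  forall s t : R, 1 <= t -> 1 <= s ->
    energy t - energy s <= C * G t - k * \sum_(j | W j) (l j s - l j t) ^+ 2.
Proof.
have [L L0 lL] := l_bounded.
have [y [C C0 [yC gy]]] := gradient_in_row_space.
have kpos j : W j -> 0 < w j / L ^+ 3.
  by move=> Wj; rewrite divr_gt0 ?exprn_gt0 // lt_def (Wj : w j != 0) w_ge0.
have [k k0 kW] := exists_pos_lb kpos.
(* The sum collects the Young constants; the extra 1 keeps the constant positive when no weight is
   nonzero. *)
exists (1 + \sum_(j | W j) C / (2 * k)).
  rewrite ltr_pwDl // sumr_ge0 // => j _.
  by rewrite divr_ge0 // ?mulr_ge0 // ltW.
exists (k / 2); first lra.
move=> s t t1 s1.
have t0 : 0 <= t := le_trans ler01 t1.
have s0 : 0 <= s := le_trans ler01 s1.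
have lin : \sum_i phi i * l i t - \sum_i phi i * l i s = - \sum_i b i * (p i s - p i t).
  rewrite sum_b opprK -sumrB; apply: eq_bigr => i _.
  rewrite -mulrBr; congr (_ * _); rewrite /l opprK addrC -sumrB.
  by apply: eq_bigr => j _; ring.
have conv : \sum_j w j / l j t - \sum_j w j / l j s <=
   \sum_j (w j * ((l j s - l j t) / l j t ^+ 2)) - \sum_(j | W j) k * (l j s - l j t) ^+ 2.
  rewrite -sumrB [X in _ <= _ - X]big_mkcond -sumrB; apply: ler_sum => j _.
  rewrite -mulrBr; have := inv_convexity (l_gt0 j t0) (l_gt0 j s0) (lL j t t1) (lL j s s1).
  move=> /(ler_wpM2l (w_ge0 j)) => h; apply: le_trans h _.
  rewrite mulrBr lerD2l lerN2; case: ifP => [Wj|/negbFE/eqP ->]; last by rewrite mul0r.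
  rewrite (_ : w j * _ = w j / L ^+ 3 * (l j s - l j t) ^+ 2); last by ring.
  by apply: ler_wpM2r; [exact: sqr_ge0|exact: kW].
(* The first-order terms of the two parts of the energy assemble into the pairing with the full
   gradient. *)
have grad : - \sum_i b i * (p i s - p i t) +
    \sum_j (w j * ((l j s - l j t) / l j t ^+ 2)) = - \sum_i g i t * (p i s - p i t).
  have -> : \sum_i g i t * (p i s - p i t) = \sum_i b i * (p i s - p i t) +
      \sum_i (p i s - p i t) * \sum_j A i j * (w j / l j t ^+ 2).
    by rewrite -big_split /=; apply: eq_bigr => i _; rewrite /g; ring.
  rewrite opprD; congr (_ + _); rewrite sum_sym -sumrN; apply: eq_bigr => j _.
  have -> : l j s - l j t = - \sum_i A j i * (p i s - p i t).
    rewrite /l opprK addrC -sumrB -sumrN; apply: eq_bigr => i _; ring.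
  by ring.
rewrite gy in grad.
have yl : - \sum_(j | W j) y j t * \sum_i A j i * (p i s - p i t) =
    \sum_(j | W j) y j t * (l j s - l j t).
  rewrite -sumrN; apply: eq_bigr => j _; rewrite -mulrN; congr (_ * _).
  by rewrite /l opprK addrC -sumrB -sumrN; apply: eq_bigr => i _; ring.
have young : \sum_(j | W j) y j t * (l j s - l j t) <=
    \sum_(j | W j) (C / (2 * k) * G t + k / 2 * (l j s - l j t) ^+ 2).
  apply: ler_sum => j _; set x := l j s - l j t.
  have h : y j t * x <= y j t ^+ 2 / (2 * k) + k / 2 * x ^+ 2.
    rewrite -subr_ge0 (_ : _ - _ = (y j t - k * x) ^+ 2 / (2 * k)).
      by rewrite divr_ge0 ?sqr_ge0 // mulr_ge0 // ltW.
    by field; rewrite gt_eqF.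
  apply: le_trans h _; rewrite lerD2r [C / _ * _]mulrAC; apply: ler_wpM2r => //.
  by rewrite invr_ge0 mulr_ge0 // ltW.
rewrite big_split /= -mulr_suml -[X in _ <= _ + X]mulr_sumr in young.
rewrite -mulr_sumr in conv.
have := G_ge0 t; rewrite /energy mulrDl mul1r; lra.
Qed.

(** The energy decreases, so in [energy_gap] the left side is nonnegative for [s] after [t]: one
    time with small gradient controls these lengths at all later times. *)
Lemma l_cauchy j : W j -> cvg (l j t @[t --> +oo]).
Proof.
move=> Wj; have [C C0 [k k0 gap]] := energy_gap.
apply: cvg_pinfty_cauchy => e e0.
have ke : 0 < k * e ^+ 2 / C by rewrite divr_gt0 // mulr_gt0 // exprn_gt0.
have [t t1 Gt] := G_small 1 ke; exists t => s ts.
have t0 : 0 < t := lt_le_trans ltr01 t1.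
have s1 : 1 <= s := le_trans t1 ts.
rewrite -(ler_pXn2r (n := 2)) ?nnegrE ?(ltW e0) // real_normK ?num_real //.
rewrite -(ler_pM2l k0); apply: (@le_trans _ _ (C * G t)); last first.
  by move: Gt; rewrite ltr_pdivlMr // mulrC => /ltW.
have := gap s t t1 s1; have := energy_decr t0 ts.
suff : k * (l j s - l j t) ^+ 2 <= k * \sum_(i | W i) (l i s - l i t) ^+ 2 by lra.
rewrite ler_pM2l // (bigD1 j) //= lerDl sumr_ge0 // => i _; exact: sqr_ge0.
Qed.

(** While [l i] is at least [e], the speed of [p i] is at most [phi i / e] times the norm of the
    gradient. The excess of the energy over its infimum satisfies the gradient inequality by
    [energy_gap], with [s] arbitrary. *)
Lemma p_cvg i (e t0 : R) : 0 < e -> (forall t, t0 <= t -> e <= l i t) ->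
  cvg (p i t @[t --> +oo]).
Proof.
move=> e0 el; have [C C0 [k k0 gap]] := energy_gap.
have [d d0 dG] := denergy_le.
pose a := Num.max 1 t0.
have a1 t : a < t -> 1 < t by rewrite gt_max => /andP[].
have at0 t : a < t -> t0 < t by rewrite gt_max => /andP[].
have a0 t : a < t -> 0 < t by move=> /a1; exact: lt_trans ltr01.
pose E := [set energy s | s in [set s : R | 1 <= s]].
have hiE : has_inf E.
  split; first by exists (energy 1), 1 => /=.
  by exists 0 => _ [s /= s1 <-]; apply: energy_ge0; exact: le_trans ler01 s1.
apply: (@cvg_of_gradient_inequality _ (p i) (dp i) (fun t => energy t - inf E) denergy G
  a d C ((phi i / e) ^+ 2)) => //.
- by move=> t /a0; exact: p_derive.
- move=> t /a0 t0'.
  have D := is_deriveB (is_derive_energy t0') (is_derive_cst (inf E) t (1 : R)).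
  by apply: is_derive_eq D _; rewrite subr0.
- move=> t /a1/ltW t1; rewrite subr_ge0; apply: ge_inf; first by case: hiE.
  by exists t.
- by move=> t /a1; exact: dG.
- move=> t /a1/ltW t1; rewrite lerBlDr addrC -lerBlDr.
  apply: lb_le_inf; first by case: hiE.
  move=> _ [s /= s1 <-]; have := gap s t t1 s1.
  suff : 0 <= k * \sum_(j | W j) (l j s - l j t) ^+ 2 by lra.
  by rewrite mulr_ge0 ?(ltW k0) // sumr_ge0 // => j _; exact: sqr_ge0.
- move=> t at_; have t0' := a0 t at_.
  have lt0 : 0 < l i t by apply: l_gt0; exact: ltW.
  have -> : dp i t = - (phi i / l i t * g i t).
    apply: (mulfI (lt0r_neq0 lt0)); rewrite flow //; field.
    exact: lt0r_neq0.
  rewrite sqrrN exprMn; apply: ler_pM; rewrite ?sqr_ge0 //; last exact: sqr_le_sum_sqr.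
  rewrite lerXn2r ?nnegrE ?divr_ge0 ?phi_ge0 ?(ltW e0) ?(ltW lt0) //.
  apply: ler_wpM2l; first exact: phi_ge0.
  by rewrite lef_pV2 ?posrE // el // ltW // at0.
Qed.

Theorem gradient_flow_converges : exists lam : 'I_n -> R,
  [/\ forall j, w j != 0 -> 0 < lam j /\ l j t @[t --> +oo] --> lam j,
      forall i, b i + \sum_j A i j * (w j / lam j ^+ 2) = 0
    & forall i (e t0 : R), 0 < e -> (forall t, t0 <= t -> e <= l i t) ->
        cvg (p i t @[t --> +oo])].
Proof.
(* If [w j = 0] the limit may fail to exist and the value is meaningless; it then occurs only with
   the factor [w j]. *)
pose lam j := lim (l j t @[t --> +oo]).
have l_lam j : w j != 0 -> l j t @[t --> +oo] --> lam j by exact: l_cauchy.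
have lam0 j : w j != 0 -> 0 < lam j.
  move=> wj; have [d d0 dl] := l_bounded_below.
  apply: lt_le_trans d0 _; apply: limr_ge; first exact: l_cauchy.
  by near=> t; apply: dl => //; near: t; apply: nbhs_pinfty_ge; rewrite num_real.
exists lam; split; [by move=> j wj; split; [exact: lam0|exact: l_lam]| |exact: p_cvg].
move=> i; set gam := b i + _.
have g_gam : g i t @[t --> +oo] --> gam.
  apply: cvgD; first exact: cvg_cst.
  apply: cvg_big => [|j _]; first exact: add_continuous.
  have [->|wj] := eqVneq (w j) 0.
    by under eq_fun do rewrite mul0r mulr0; rewrite mul0r mulr0; exact: cvg_cst.
  apply: cvgM; first exact: cvg_cst.
  apply: cvgM; first exact: cvg_cst.
  apply: cvgV; first by rewrite expf_neq0 // gt_eqF // lam0.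
  by rewrite expr2; under eq_fun do rewrite expr2; apply: cvgM; exact: l_lam.
(* A nonzero limit of one component would keep [G] away from 0, against [G_small]. *)
apply/eqP/negPn/negP => gam0.
have e0 : 0 < (`|gam| / 2) ^+ 2 by rewrite exprn_gt0 // divr_gt0 ?normr_gt0.
have : \forall t \near +oo, `|gam| / 2 < `|g i t|.
  apply: (cvgr_gt `|gam|); first exact: cvg_norm.
  have : 0 < `|gam| by rewrite normr_gt0.
  by lra.
move=> [M [_ HM]].
have [t Mt Gt] := G_small (M + 1) e0.
have := HM t (lt_le_trans _ Mt); rewrite ltrDl ltr01 => /(_ isT) gt.
have := sqr_le_sum_sqr (fun i => g i t) i; rewrite -/(G t) leNgt => /negP; apply.
apply: lt_trans Gt _; rewrite -(real_normK (num_real (g i t))).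
by rewrite ltrXn2r ?nnegrE // divr_ge0.
Unshelve. all: by end_near. Qed.

End gradient_flow.

(** * Kuratowski convergence of segments *)

(** For a proper filter the lower limit lies in the upper one, so it suffices to put [L] inside the
    former and the latter inside [L]. *)
Lemma kuratowski_cvgP (R : realType) (T : Type) (F : set_system T)
    {FF : ProperFilter F} (A : T -> set 'rV[R]_2) (L : set 'rV[R]_2) :
  (forall x, L x -> forall U, nbhs x U -> \forall t \near F, A t `&` U !=set0) ->
  (forall x, ~ L x -> exists2 U, nbhs x U & \forall t \near F, A t `&` U = set0) ->
  kuratowski_cvg F A L.
Proof.
move=> inL outL; have limsupL : kuratowski_limsup F A `<=` L.
  move=> x /= xsup; apply: contrapT => /outL[U /xsup nU]; exact: nU.
have liminf_limsup : kuratowski_liminf F A `<=` kuratowski_limsup F A.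
  move=> x /= xinf U /xinf nU eU; apply: (@filter_not_empty _ F FF).
  by apply: filterS2 nU eU => t /= [y ?] e0; move: (y) e0 => ?; rewrite -subset0 => /(_ y); apply.
split; apply/seteqP; split.
- exact: subset_trans liminf_limsup limsupL.
- by move=> x /inL.
- exact: limsupL.
- by apply: subset_trans liminf_limsup => x /inL.
Qed.

Lemma seg_set_cvg (R : realType) (T : Type) (F : set_system T)
    {FF : Filter F} (a b : T -> 'rV[R]_2) (p q : 'rV[R]_2) :
  a t @[t --> F] --> p -> b t @[t --> F] --> q ->
  (forall x, seg_set (p, q) x -> forall U, nbhs x U ->
     \forall t \near F, seg_set (a t, b t) `&` U !=set0) /\
  (forall x, ~ seg_set (p, q) x -> exists2 U, nbhs x U &
     \forall t \near F, seg_set (a t, b t) `&` U = set0).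
Proof.
move=> ap bq; split=> x.
  move=> [u u01 <-] U; rewrite /= => xU.
  have cv : (1 - u) *: a t + u *: b t @[t --> F] --> (1 - u) *: p + u *: q.
    apply: cvgD; apply: cvgZ; first exact: cvg_cst.
    - exact: ap.
    - exact: cvg_cst.
    - exact: bq.
  have cvU : \forall t \near F, U ((1 - u) *: a t + u *: b t) := cv U xU.
  apply: filterS cvU => t Ut.
  by exists ((1 - u) *: a t + u *: b t); split => //; exists u.
move=> xL.
(* The limit segment is compact, hence closed, and misses a ball of radius [e] around [x]. Points
   with the same parameter on the two segments end up within [e / 2] of each other, so the ball of
   half the radius misses the moving segment. *)
have cpt : compact (seg_set (p, q)).
  rewrite (_ : seg_set _ = (fun u : R => (1 - u) *: p + u *: q) @` `[0, 1]) //.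
  apply: continuous_compact.
    apply: continuous_subspaceT => u; apply: cvgD.
    by apply: cvgZ; [apply: cvgB; [exact: cvg_cst|exact: cvg_id]|exact: cvg_cst].
  by apply: cvgZ; [exact: cvg_id|exact: cvg_cst].
  exact: segment_compact.
have := compact_closed (@norm_hausdorff _ _) cpt.
rewrite closedE => /(_ x) cl.
have /nbhs_ballP[e /= e0 He] : nbhs x (~` seg_set (p, q)).
  by apply: contrapT => h; apply: xL; apply: cl => /= h'; apply: h; exact: h'.
exists (ball x (e / 2)); first by apply: nbhsx_ballx; rewrite divr_gt0.
have e2 : 0 < e / 2 by rewrite divr_gt0.
have /cvgrPdist_lt/(_ _ e2) := ap; have /cvgrPdist_lt/(_ _ e2) := bq.
apply: filterS2 => t /= bt at_.
rewrite -subset0 => y [[u /= u01 <-]]; rewrite -ball_normE /= => xy.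
apply: (He ((1 - u) *: p + u *: q)); last by exists u.
rewrite -ball_normE /=.
set y' := (1 - u) *: a t + u *: b t in xy *.
have -> : x - ((1 - u) *: p + u *: q) =
   (x - y') - ((1 - u) *: (p - a t) + u *: (q - b t)).
  by rewrite /y' !scalerBr; apply/rowP => j; rewrite !mxE; ring.
move: u01; rewrite in_itv /= => /andP[u0 u1].
apply: le_lt_trans (ler_normB _ _) _.
have : `|(1 - u) *: (p - a t) + u *: (q - b t)| <= (1 - u) * (e / 2) + u * (e / 2).
  apply: le_trans (ler_normD _ _) _; rewrite !normrZ (ger0_norm u0) ger0_norm; last lra.
  by apply: lerD; apply: ler_wpM2l; rewrite ?(ltW bt) ?(ltW at_) // subr_ge0.
have -> : (1 - u) * (e / 2) + u * (e / 2) = e / 2 by ring.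
lra.
Qed.

Lemma kuratowski_cvg_bigcup_seg (R : realType) (T : Type) (F : set_system T)
    {FF : ProperFilter F} (n : nat) (a b : nat -> T -> 'rV[R]_2)
    (p q : nat -> 'rV[R]_2) :
  (forall i, (i < n)%N -> a i t @[t --> F] --> p i) ->
  (forall i, (i < n)%N -> b i t @[t --> F] --> q i) ->
  kuratowski_cvg F (fun t => \bigcup_(i in `I_n) seg_set (a i t, b i t))
    (\bigcup_(i in `I_n) seg_set (p i, q i)).
Proof.
move=> ap bq; apply: kuratowski_cvgP => x.
  move=> [i /= ni xi] U xU; have [inL _] := seg_set_cvg (ap i ni) (bq i ni).
  have := inL x xi U xU; apply: filterS => t [y [yS yU]].
  by exists y; split => //; exists i.
move=> xL.
(* One neighbourhood is chosen per segment; finiteness allows intersecting both the neighbourhoods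
   and the eventual conditions. *)
have /choice[U HU] : forall i, exists U, (i < n)%N ->
    nbhs x U /\ \forall t \near F, seg_set (a i t, b i t) `&` U = set0.
  move=> i; have [ni|_] := boolP (i < n)%N; last by exists setT.
  have [_ outL] := seg_set_cvg (ap i ni) (bq i ni).
  by have [|U xU tU] := outL x; [move=> xi; apply: xL; exists i|exists U].
have H1 : nbhs x (fun y => forall i : 'I_n, U i y).
  apply: (@filter_forall _ _ (fun (i : 'I_n) y => U i y) _ (nbhs_filter x)) => i.
  by have [] := HU i (ltn_ord i).
have H2 : \forall t \near F, forall i : 'I_n, seg_set (a i t, b i t) `&` U i = set0.
  apply: (@filter_forall _ _ (fun (i : 'I_n) t => seg_set (a i t, b i t) `&` U i = set0) F _) => i.
  by have [] := HU i (ltn_ord i).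
exists (fun y => forall i : 'I_n, U i y); first exact: H1.
apply: filterS H2 => t Ht; rewrite -subset0 => y [[i /= ni yi] yU].
suff : (set0 : set 'rV[R]_2) y by [].
by rewrite -(Ht (Ordinal ni)); split => //; exact: (yU (Ordinal ni)).
Qed.

Lemma kuratowski_cvg_seg (R : realType) (T : Type) (F : set_system T)
    {FF : ProperFilter F} (a b : T -> 'rV[R]_2) (p q : 'rV[R]_2) :
  a t @[t --> F] --> p -> b t @[t --> F] --> q ->
  kuratowski_cvg F (fun t => seg_set (a t, b t)) (seg_set (p, q)).
Proof.
by move=> ap bq; have [? ?] := seg_set_cvg ap bq; exact: kuratowski_cvgP.
Qed.

Lemma kuratowski_cvg_near (R : realType) (T : Type) (F : set_system T)
    {FF : Filter F} (A B : T -> set 'rV[R]_2) (L : set 'rV[R]_2) :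
  (\forall t \near F, A t = B t) -> kuratowski_cvg F A L -> kuratowski_cvg F B L.
Proof.
move=> AB [infL supL]; split.
  rewrite -infL; apply/seteqP; split=> x /= H U xU.
    by apply: filterS2 AB (H U xU) => t ->.
  by apply: filterS2 AB (H U xU) => t ->.
rewrite -supL; apply/seteqP; split=> x /= H U xU nU; apply: (H U xU).
  by apply: filterS2 AB nU => t ->.
by apply: filterS2 AB nU => t ->.
Qed.

(** * Collapsing closed curves *)

Lemma seg_set_split (R : realType) (a x b : 'rV[R]_2) :
  seg_set (a, b) x -> seg_set (a, b) = seg_set (a, x) `|` seg_set (x, b).
Proof.
move=> [u /=]; rewrite in_itv /= => /andP[u0 u1] <-.
apply/seteqP; split=> y.
  move=> [s /=]; rewrite in_itv /= => /andP[s0 s1] <-.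
  have [su|us] := leP s u.
    left; have [u_eq0|u_neq0] := eqVneq u 0.
      exists 0; first by rewrite /= in_itv /= lexx ler01.
      have -> : s = 0 by lra.
      by rewrite u_eq0; apply/rowP => j; rewrite !mxE; ring.
    have u_gt0 : 0 < u by rewrite lt_def u_neq0.
    exists (s / u); first by rewrite /= in_itv /= divr_ge0 //= ler_pdivrMr // mul1r.
    by apply/rowP => j; rewrite !mxE; field.
  right; have u_lt1 : u < 1 by lra.
  have nz : 1 - u != 0 by rewrite gt_eqF // subr_gt0.
  exists ((s - u) / (1 - u)).
    rewrite /= in_itv /= divr_ge0 ?subr_ge0 ?(ltW us) //=.
    by rewrite ler_pdivrMr ?subr_gt0 // mul1r; lra.
  by apply/rowP => j; rewrite !mxE; field.
case=> -[s /=]; rewrite in_itv /= => /andP[s0 s1] <-.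
  exists (s * u); first by rewrite /= in_itv /= mulr_ge0 //= mulr_ile1.
  by apply/rowP => j; rewrite !mxE; ring.
exists (u + s * (1 - u)).
  by rewrite /= in_itv /=; apply/andP; split; nra.
by apply/rowP => j; rewrite !mxE; ring.
Qed.

Lemma seg_set_left (R : realType) (a b : 'rV[R]_2) : seg_set (a, b) a.
Proof.
exists 0; first by rewrite /= in_itv /= lexx ler01.
by rewrite /= subr0 scale1r scale0r addr0.
Qed.

Lemma seg_set_right (R : realType) (a b : 'rV[R]_2) : seg_set (a, b) b.
Proof.
exists 1; first by rewrite /= in_itv /= lexx ler01.
by rewrite /= subrr scale1r scale0r add0r.
Qed.

(** * Cyclic indices and invariance under collapse *)

Lemma vtx_mod (R : realType) (G : curve R) i : vtx G (i %% size G) = vtx G i.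
Proof. by rewrite /vtx modn_mod. Qed.

Lemma seg_mod (R : realType) (G : curve R) i : seg G (i %% size G) = seg G i.
Proof.
rewrite /seg vtx_mod; congr (_, _); rewrite /vtx.
by congr (G`_ _); rewrite -addn1 modnDml addn1.
Qed.

Lemma nth_rot_mod (T : Type) (x0 : T) (s : seq T) k i : (k <= size s)%N ->
  nth x0 (rot k s) (i %% size s) = nth x0 s ((i + k) %% size s).
Proof.
move=> ks; have [s0|s_gt0] := posnP (size s); first by rewrite (size0nil s0) !nth_nil.
have: (i %% size s < size s)%N by rewrite ltn_mod.
rewrite -modnDml; move: (i %% size s)%N => {}i it.
rewrite /rot nth_cat size_drop nth_drop; case: ltnP => ik.
  by rewrite modn_small; [rewrite addnC|lia].
rewrite nth_take; last lia.
have -> : (i + k = (i - (size s - k)) + size s)%N by lia.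
by rewrite modnDr modn_small //; lia.
Qed.

Lemma vtx_rot (R : realType) (G : curve R) k i :
  (k <= size G)%N -> vtx (rot k G) i = vtx G (i + k).
Proof. by move=> kG; rewrite /vtx size_rot nth_rot_mod. Qed.

Lemma rot_bounded_shift (R : realType) (G : curve R) k :
  exists2 k', (k' <= size G)%N & rot k G = rot k' G.
Proof.
have [kG|Gk] := leqP k (size G); first by exists k.
by exists 0%N => //; rewrite rot0 rot_oversize // ltnW.
Qed.

Lemma curve_set_all (R : realType) (G : curve R) (i : nat) :
  (0 < size G)%N -> seg_set (seg G i) `<=` curve_set G.
Proof.
by move=> G0 x xi; exists (i %% size G)%N; rewrite /= ?ltn_mod // seg_mod.
Qed.

Lemma curve_set_rot (R : realType) (G : curve R) k :
  curve_set (rot k G) = curve_set G.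
Proof.
have [k' kG ->] := rot_bounded_shift G k.
have [G0|G_gt0] := posnP (size G); first by rewrite (size0nil G0).
apply/seteqP; split=> x [i /= iG].
  rewrite /seg !vtx_rot // addSn => xi.
  exact: (@curve_set_all _ _ (i + k')).
move=> xi; apply: (@curve_set_all _ _ (i + (size G - k'))); first by rewrite size_rot.
rewrite /seg !vtx_rot // -(vtx_mod G (_ + _ + _)) -(vtx_mod G (_.+1 + _)).
have -> : (i + (size G - k') + k' = i + size G)%N by lia.
have -> : ((i + (size G - k')).+1 + k' = i.+1 + size G)%N by lia.
by rewrite !modnDr !vtx_mod.
Qed.

(** Inserting [x] replaces the closing edge of [P] by two edges through [x], whose union is that
    edge. For empty [P] the right side would be empty. *)
Lemma curve_set_drop (R : realType) (x : 'rV[R]_2) (P : curve R) :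
  P != [::] -> seg_set (last x P, head x P) x -> curve_set (x :: P) = curve_set P.
Proof.
case: P => [//|y P] _ /= xs.
have sz : size (x :: y :: P) = (size (y :: P)).+1 by [].
have segS i : (i < size P)%N -> seg (x :: y :: P) i.+1 = seg (y :: P) i.
  by move=> iP; rewrite /seg /vtx !modn_small //= ltnS // ltnW.
have seg0 : seg (x :: y :: P) 0 = (x, y) by rewrite /seg /vtx mod0n modn_small.
have segl : seg (x :: y :: P) (size P).+1 = (last y P, x).
  rewrite /seg /vtx modnn modn_small; last exact: ltnSn.
  by rewrite /= -[nth _ _ _]/(nth 0 (y :: P) (size (y :: P)).-1) nth_last.
have segl' : seg (y :: P) (size P) = (last y P, y).
  rewrite /seg /vtx modnn modn_small; last exact: ltnSn.
  by rewrite -[size P]/((size (y :: P)).-1) nth_last.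
have split := seg_set_split xs.
apply/seteqP; split=> z [i /= iP].
  case: i iP => [|i]; rewrite !ltnS => iP.
    rewrite seg0 => zi; exists (size P); first exact: ltnSn.
    by rewrite segl' split; right.
  move: iP; rewrite leq_eqVlt => /orP[/eqP ->|iP].
    rewrite segl => zi; exists (size P); first exact: ltnSn.
    by rewrite segl' split; left.
  by rewrite segS // => zi; exists i => //=; rewrite ltnW.
move: iP; rewrite ltnS leq_eqVlt => /orP[/eqP ->|iP].
  rewrite segl' split => -[zi|zi].
    by exists (size P).+1; [exact: ltnSn|rewrite segl].
  by exists 0%N => //=; rewrite seg0.
by rewrite -segS // => zi; exists i.+1 => //=; rewrite !ltnS ltnW.
Qed.

Lemma collapse_nil (R : realType) (P Q : curve R) : collapse P Q -> P = [::] -> Q = [::].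
Proof.
by elim=> // k P' Q' _ IH P0; apply: IH; rewrite P0.
Qed.

Lemma curve_set_collapse (R : realType) (P Q : curve R) :
  collapse P Q -> (0 < size Q)%N -> curve_set P = curve_set Q.
Proof.
elim=> // [k P' Q' _ IH|x P' Q' xs PQ IH] Q0.
  by rewrite -IH // curve_set_rot.
rewrite -IH // curve_set_drop //; apply/eqP => P0.
by rewrite (collapse_nil PQ P0) in Q0.
Qed.

Lemma size_collapse (R : realType) (P Q : curve R) : collapse P Q -> (size Q <= size P)%N.
Proof.
elim=> // [k P' Q' _|x P' Q' _ _ /= /leq_trans-> //]; by rewrite size_rot.
Qed.

(** Rotations alone preserve a degenerate segment, so at least one vertex is erased. This makes
    every restart strictly decrease the number of segments. *)
Lemma size_collapse_degenerate (R : realType) (P Q : curve R) :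
  collapse P Q -> (exists i, degenerate (seg P i)) ->
  (forall i, ~ degenerate (seg Q i)) -> (size Q < size P)%N.
Proof.
elim=> [P' [i di] nd|k P' Q' _ IH [i di] nd|x P' Q' _ PQ _ _ _].
- by have := nd i.
- have [k' kP Ek] := rot_bounded_shift P' k.
  rewrite -(size_rot k P'); apply: IH nd; rewrite Ek.
  have [P0|P_gt0] := posnP (size P').
    by exists i; move: di; rewrite (size0nil P0) rot_oversize.
  exists (i + (size P' - k'))%N.
  rewrite /degenerate /seg !vtx_rot //= -(vtx_mod P' (_ + _ + _)) -(vtx_mod P' (_.+1 + _)).
  have -> : (i + (size P' - k') + k' = i + size P')%N by lia.
  have -> : ((i + (size P' - k')).+1 + k' = i.+1 + size P')%N by lia.
  by rewrite !modnDr !vtx_mod.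
by rewrite /= ltnS; exact: size_collapse.
Qed.

(** * Removing degenerate edges from closed chains *)

Lemma periodic_mod (T : Type) (f : nat -> T) (n : nat) :
  (forall i, f (i + n)%N = f i) -> forall i, f (i %% n)%N = f i.
Proof.
move=> fn i; rewrite [in RHS](divn_eq i n) addnC.
by elim: (i %/ n)%N => [|k IH]; rewrite ?mul0n ?addn0 // mulSn [(n + _)%N]addnC addnA fn.
Qed.

Lemma rot_mkseq (T : Type) (v : nat -> T) (n k : nat) : (k <= n)%N ->
  (forall i, v (i + n)%N = v i) -> rot k (mkseq v n) = mkseq (fun i => v (i + k)%N) n.
Proof.
move=> kn vn; apply: (@eq_from_nth _ (v 0%N)); rewrite size_rot !size_mkseq // => i it.
have n0 : (0 < n)%N by exact: leq_ltn_trans it.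
rewrite [in RHS]nth_mkseq //.
have := @nth_rot_mod _ (v 0%N) (mkseq v n) k i; rewrite size_mkseq => /(_ kn).
by rewrite modn_small // => ->; rewrite nth_mkseq ?ltn_mod // periodic_mod.
Qed.

Lemma modn_succ (m i : nat) : (0 < m)%N ->
  ((i %% m).+1 < m)%N /\ (i.+1 %% m = (i %% m).+1)%N \/
  (i %% m = m.-1)%N /\ (i.+1 %% m = 0)%N.
Proof.
move=> m0; have im : (i %% m < m)%N by rewrite ltn_mod.
have [h|h] := ltnP (i %% m).+1 m.
  by left; split=> //; rewrite -addn1 -modnDml addn1 modn_small.
have e : (i %% m = m.-1)%N by lia.
by right; split=> //; rewrite -addn1 -modnDml addn1 e prednK // modnn.
Qed.

(* The closed polygon with vertices [v i] and edges [l i *: tau i], some of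
   which may be degenerate; indices are read modulo [n]. *)
Definition closed_chain (R : realType) (Q : 'rV[R]_2 -> 'rV[R]_2 -> Prop) (n : nat)
    (v tau : nat -> 'rV[R]_2) (l : nat -> R) : Prop :=
  [/\ [/\ forall i, v (i + n)%N = v i, forall i, tau (i + n)%N = tau i
        & forall i, l (i + n)%N = l i],
      forall i, v i.+1 = v i + l i *: tau i,
      forall i, 0 <= l i /\ tau i != 0,
      forall i, Q (tau i) (tau i.+1)
    & forall i, l i.+1 = 0 -> 0 < l i /\ tau i = tau i.+2].

Lemma closed_chain_shift (R : realType) (Q : 'rV[R]_2 -> 'rV[R]_2 -> Prop) (n k : nat)
    (v tau : nat -> 'rV[R]_2) (l : nat -> R) :
  closed_chain Q n v tau l ->
  closed_chain Q n (fun i => v (i + k)%N) (fun i => tau (i + k)%N) (fun i => l (i + k)%N).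
Proof.
move=> [[vn tn ln] vS l0 Qt lS]; split.
- by split=> i; rewrite addnAC.
- by move=> i; rewrite addSn.
- by move=> i.
- by move=> i; rewrite addSn.
- by move=> i; rewrite !addSn; exact: lS.
Qed.

(** The neighbours of a degenerate edge have positive length and equal directions, so erasing both
    its end points merges them into one edge. The merged edge is again positive, which preserves the
    last condition of [closed_chain]; equality of the directions preserves [Q]. *)
Lemma closed_chain_reduce (R : realType) (Q : 'rV[R]_2 -> 'rV[R]_2 -> Prop) (n : nat)
    (v tau : nat -> 'rV[R]_2) (l : nat -> R) :
  (0 < n)%N -> l 0%N = 0 -> closed_chain Q n v tau l ->
  exists m v' tau' l', [/\ (0 < m < n)%N, closed_chain Q m v' tau' l' &
    forall P, collapse (mkseq v' m) P -> collapse (mkseq v n) P].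
Proof.
move=> + lk [[vn tn ln] vS l0 Qt lS].
have l1 : 0 < l 1%N.
  by rewrite lt_def (l0 1%N).1 andbT; apply/eqP => /lS[]; rewrite lk ltxx.
(* A single edge would be both degenerate and positive; with two edges, the positive one would have
   to close up by itself. *)
case: n vn tn ln => [//|[|[|m]]] vn tn ln _.
- by move: l1; rewrite (etrans (ln 0%N) lk : l 1%N = 0) ltxx.
- have := vS 1%N; rewrite (vS 0%N) lk scale0r addr0 (vn 0%N : v 2%N = v 0%N) => /eqP.
  rewrite addrC -subr_eq subrr eq_sym scaler_eq0 (negbTE (l0 1%N).2) orbF.
  by rewrite gt_eqF.
have ln3 : l m.+3 = 0 := etrans (ln 0%N) lk.
have [lm tm] := lS _ ln3; rewrite (tn 1%N : tau m.+4 = _) in tm.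
have v1 : v 1%N = v 0%N by rewrite vS lk scale0r addr0.
have v3 : v m.+3 = v 0%N := vn 0%N.
pose s := m.+1.
pose v' i := v (i %% s).+2.
pose tau' i := tau (i %% s).+2.
(* The new chain starts at [v 2], so the merged edge from [v m.+2] back to [v 2] is its last one, of
   index [m]. *)
pose l' i := if (i %% s == m)%N then l m.+2 + l 1%N else l (i %% s).+2.
have vE : mkseq v m.+3 = v 0%N :: v 1%N :: mkseq v' s.
  rewrite /mkseq -[m.+3]/(2 + s)%N iotaD map_cat [(0 + 2)%N]addnC iotaDl -map_comp /=.
  congr [:: _, _, _ & _].
  apply/eq_in_map => i; rewrite mem_iota => /andP[_ im].
  by rewrite /v' modn_small // add2n.
have lastv : last (v 0%N) (mkseq v' s) = v m.+2.
  by rewrite (last_nth (v 0%N)) size_mkseq /= -/(mkseq v' s) nth_mkseq // /v' modn_small.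
have l'm i : (i %% s = m)%N -> l' i = l m.+2 + l 1%N by move=> e; rewrite /l' e eqxx.
have l'i i : ((i %% s).+1 < s)%N -> l' i = l (i %% s).+2.
  by move=> e; rewrite /l' ifF //; apply/eqP; lia.
have v2E : v 2%N = v m.+2 + (l m.+2 + l 1%N) *: tau m.+2.
  by rewrite scalerDl addrA -vS v3 tm -v1 -vS.
exists s, v', tau', l'; split.
- by rewrite /s; lia.
- split.
  + by split=> i; rewrite /v' /tau' /l' modnDr.
  + move=> i; case: (@modn_succ s i isT) => -[e e'].
      by rewrite /v' e' l'i // vS.
    by rewrite l'm // /v' /tau' e' e /= v2E.
  + move=> i; split; last exact: (l0 _).2.
    case: (@modn_succ s i isT) => -[e e']; first by rewrite l'i // (l0 _).1.
    by rewrite l'm // addr_ge0 // (l0 _).1.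
  + move=> i; case: (@modn_succ s i isT) => -[e e']; rewrite /tau' e' //.
    by rewrite e /= tm; exact: Qt.
  + move=> i; case: (@modn_succ s i.+1 isT) => -[e e']; last first.
      by rewrite l'm // => /eqP; rewrite gt_eqF // addr_gt0.
    rewrite l'i //; case: (@modn_succ s i isT) => -[f f'].
      by rewrite /tau' e' f' l'i // => /lS.
    by rewrite /tau' e' f' f /= l'm // tm => /lS[_ ->]; rewrite addr_gt0.
(* First [v 0] is erased, since it coincides with [v 1]; then [v 1], which lies between [v m.+2] and
   [v 2] because the two merged edges have the same direction. *)
- move=> P vP; rewrite vE; apply: collapse_drop.
    have H : seg_set (last (v 1%N) (mkseq v' s), v 1%N) (v 0%N).
      by rewrite v1 lastv; exact: seg_set_right.
    exact: H.
  apply: collapse_drop => //.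
  suff: seg_set (last (v 1%N) (mkseq v' s), v 2%N) (v 1%N) by [].
  rewrite v1 lastv v2E.
  have L0 : 0 < l m.+2 + l 1%N by rewrite addr_gt0.
  exists (l m.+2 / (l m.+2 + l 1%N)).
    rewrite /= in_itv /=; apply/andP; split; first by rewrite divr_ge0 // ltW.
    by rewrite ler_pdivrMr // mul1r lerDl ltW.
  rewrite /= -v3 (vS m.+2); apply/rowP => j; rewrite !mxE; field.
  by rewrite gt_eqF.
Qed.

(** Strong induction on the number of edges: a degenerate edge is rotated to index 0 and removed.
    [Q] records which pairs of directions may be consecutive, and this is what makes the limit curve
    admissible. *)
Lemma closed_chain_collapse (R : realType) (Q : 'rV[R]_2 -> 'rV[R]_2 -> Prop) (n : nat)
    (v tau : nat -> 'rV[R]_2) (l : nat -> R) :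
  (0 < n)%N -> closed_chain Q n v tau l ->
  exists (P : curve R) (tau' : nat -> 'rV[R]_2) (l' : nat -> R),
    [/\ collapse (mkseq v n) P, (0 < size P)%N,
        forall i, vtx P i.+1 = vtx P i + l' i *: tau' i,
        forall i, 0 < l' i & forall i, Q (tau' i) (tau' i.+1)].
Proof.
elim/ltn_ind: n v tau l => n IH v tau l n0 ch.
have [[vn tn ln] vS l0 Qt lS] := ch.
have [lpos|] := pselect (forall i, 0 < l i).
  exists (mkseq v n), tau, l; split=> //; first exact: collapse_refl.
    by rewrite size_mkseq.
  have vE i : vtx (mkseq v n) i = v i.
    by rewrite /vtx size_mkseq nth_mkseq ?ltn_mod // periodic_mod.
  by move=> i; rewrite !vE.
move=> /existsNP[k0 /negP]; rewrite lt_def (l0 _).1 andbT negbK => /eqP lk0.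
pose k := (k0 %% n)%N.
have lk : l (0 + k)%N = 0 by rewrite add0n /k (periodic_mod ln).
have kn : (k <= n)%N by rewrite ltnW // ltn_mod.
have [m [v' [tau' [l' [/andP[m0 mn] ch' cP]]]]] :=
  closed_chain_reduce n0 lk (closed_chain_shift k ch).
have [P [tau1 [l1 [/cP mP P0 vP lP QP]]]] := IH m mn v' tau' l' m0 ch'.
exists P, tau1, l1; split=> //; apply: (@collapse_rot _ k).
by rewrite rot_mkseq.
Qed.

(** * Plane geometry *)

Lemma dotE (R : realType) (x y : 'rV[R]_2) : dot x y = x 0 0 * y 0 0 + x 0 1 * y 0 1.
Proof.
rewrite /dot !big_ord_recl big_ord0 addr0.
by rewrite (_ : lift ord0 ord0 = 1) //; exact: val_inj.
Qed.

Lemma row2P (R : realType) (x y : 'rV[R]_2) : x 0 0 = y 0 0 -> x 0 1 = y 0 1 -> x = y.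
Proof.
move=> x0 x1; apply/rowP => j; case: j => -[|[|//]] j2.
  by rewrite (_ : Ordinal j2 = 0) //; exact: val_inj.
by rewrite (_ : Ordinal j2 = 1) //; exact: val_inj.
Qed.

(** This is the determinant of [u] and [v]; with [u] a tangent it is the component of [v] along the
    normal. *)
Definition cross (R : realType) (u v : 'rV[R]_2) : R := dot (rot90 u) v.

Lemma crossE (R : realType) (u v : 'rV[R]_2) : cross u v = u 0 0 * v 0 1 - u 0 1 * v 0 0.
Proof. by rewrite /cross dotE !mxE /=; ring. Qed.

Lemma rot90_0 (R : realType) (x : 'rV[R]_2) : rot90 x 0 0 = - x 0 1.
Proof. by rewrite !mxE. Qed.

Lemma rot90_1 (R : realType) (x : 'rV[R]_2) : rot90 x 0 1 = x 0 0.
Proof. by rewrite !mxE. Qed.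

Definition coordE := (dotE, crossE, rot90_0, rot90_1).

Lemma rot90_inj (R : realType) : injective (@rot90 R).
Proof.
move=> x y /rowP E; apply: row2P.
  by have := E 1; rewrite !rot90_1.
by have := E 0; rewrite !rot90_0 => /oppr_inj.
Qed.

Lemma dotC (R : realType) (x y : 'rV[R]_2) : dot x y = dot y x.
Proof. by rewrite !dotE; ring. Qed.

Lemma dotDr (R : realType) (x y z : 'rV[R]_2) : dot x (y + z) = dot x y + dot x z.
Proof. by rewrite !dotE !mxE; ring. Qed.

Lemma dotBr (R : realType) (x y z : 'rV[R]_2) : dot x (y - z) = dot x y - dot x z.
Proof. by rewrite !dotE !mxE; ring. Qed.

Lemma dotZr (R : realType) (x y : 'rV[R]_2) (k : R) : dot x (k *: y) = k * dot x y.
Proof. by rewrite !dotE !mxE; ring. Qed.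

Lemma dot0r (R : realType) (x : 'rV[R]_2) : dot x 0 = 0.
Proof. by rewrite dotE !mxE; ring. Qed.

Lemma dot_sumr (R : realType) (I : Type) (r : seq I) (x : 'rV[R]_2) (y : I -> 'rV[R]_2) :
  dot x (\sum_(i <- r) y i) = \sum_(i <- r) dot x (y i).
Proof.
elim/big_rec2: _ => [|i a b _ <-]; last by rewrite dotDr.
exact: dot0r.
Qed.

Lemma dot_rot90 (R : realType) (x y : 'rV[R]_2) : dot (rot90 x) (rot90 y) = dot x y.
Proof. by rewrite !coordE; ring. Qed.

Lemma dotxx_ge0 (R : realType) (x : 'rV[R]_2) : 0 <= dot x x.
Proof. by rewrite dotE addr_ge0 // -expr2 sqr_ge0. Qed.

Lemma dotxx_eq0 (R : realType) (x : 'rV[R]_2) : (dot x x == 0) = (x == 0).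
Proof.
apply/eqP/eqP => [|->]; last by rewrite dotE !mxE; ring.
rewrite dotE => E; apply: row2P; rewrite mxE; apply/eqP; rewrite -sqrf_eq0;
  apply/eqP; have := sqr_ge0 (x 0 0); have := sqr_ge0 (x 0 1); lra.
Qed.

Lemma enorm_eq0 (R : realType) (x : 'rV[R]_2) : (enorm x == 0) = (x == 0).
Proof. by rewrite /enorm sqrtr_eq0 -dotxx_eq0 eq_le dotxx_ge0 andbT. Qed.

Lemma seglen_ge0 (R : realType) (S : segment R) : 0 <= seglen S.
Proof. exact: sqrtr_ge0. Qed.

Lemma degenerateP (R : realType) (S : segment R) : degenerate S <-> seglen S = 0.
Proof.
split=> [E|/eqP]; first by apply/eqP; rewrite enorm_eq0 E subrr.
by rewrite enorm_eq0 subr_eq0 => /eqP.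
Qed.

Lemma seglen_gt0 (R : realType) (S : segment R) : ~ degenerate S -> 0 < seglen S.
Proof.
by move=> nd; rewrite lt_def seglen_ge0 andbT; apply/eqP => /degenerateP.
Qed.

Lemma dot_tangent (R : realType) (S : segment R) :
  ~ degenerate S -> dot (tangent S) (tangent S) = 1.
Proof.
move=> /seglen_gt0 S0; rewrite /tangent dotZr dotC dotZr.
rewrite -[dot _ _]sqr_sqrtr ?dotxx_ge0 // -/(enorm _) -/(seglen S).
by field; rewrite gt_eqF.
Qed.

Lemma seg_endE (R : realType) (S : segment R) : S.2 = S.1 + seglen S *: tangent S.
Proof.
have [/degenerateP S0|/seglen_gt0 S0] := pselect (degenerate S).
  by rewrite S0 scale0r addr0; move/degenerateP : S0.
by rewrite /tangent scalerA divff ?gt_eqF // scale1r addrC subrK.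
Qed.

Lemma seglen_tangent_unique (R : realType) (a b t : 'rV[R]_2) (l : R) :
  dot t t = 1 -> 0 <= l -> b = a + l *: t -> seglen (a, b) = l.
Proof.
move=> t1 l0 ->; rewrite /seglen /enorm /= [a + _]addrC addrK.
by rewrite dotZr dotC dotZr t1 mulr1 -expr2 sqrtr_sqr ger0_norm.
Qed.

Lemma tangent_unique (R : realType) (a b t : 'rV[R]_2) (l : R) :
  dot t t = 1 -> 0 < l -> b = a + l *: t -> tangent (a, b) = t.
Proof.
move=> t1 l0 E; rewrite /tangent (seglen_tangent_unique t1 (ltW l0) E) /= E.
by rewrite [a + _]addrC addrK scalerA mulVf ?gt_eqF // scale1r.
Qed.

Lemma tangent_of_normal (R : realType) (S S' : segment R) :
  normal S = normal S' -> tangent S = tangent S'.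
Proof. exact: rot90_inj. Qed.

Lemma dot_normal (R : realType) (S : segment R) x : dot (normal S) x = cross (tangent S) x.
Proof. by []. Qed.

Lemma cross_sqr (R : realType) (u v : 'rV[R]_2) : dot u u = 1 -> dot v v = 1 ->
  cross u v ^+ 2 + dot u v ^+ 2 = 1.
Proof.
move=> u1 v1; transitivity (dot u u * dot v v); last by rewrite u1 v1 mulr1.
by rewrite !coordE; ring.
Qed.

Lemma cross_antisym (R : realType) (u v : 'rV[R]_2) : cross v u = - cross u v.
Proof. by rewrite !coordE; ring. Qed.

(** Both cone tests of [seg_angle] reduce to [0 < cross u v]. The two branches have the same cosine,
    and passing to [2 * pi - acos] gives the sine the sign of [cross u v]. *)
Lemma seg_angleP (R : realType) (S S' : segment R)
    (u := tangent S) (v := tangent S') (th := seg_angle S S') :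
  dot u u = 1 -> dot v v = 1 -> cross u v != 0 ->
  [/\ sin th = cross u v, cos th = - dot u v,
      (th < pi) = (0 < cross u v) & (pi < th) = (cross u v < 0)].
Proof.
move=> u1 v1 X0; have E := cross_sqr u1 v1.
set d := dot (- u) v.
have dE : d = - dot u v by rewrite /d !dotE !mxE; ring.
have X2 : 0 < cross u v ^+ 2 by rewrite lt_def sqr_ge0 sqrf_eq0 X0.
have d2 : d ^+ 2 < 1 by rewrite dE sqrrN; lra.
have d1 : d < 1 by rewrite ltNge; apply/negP => h; move: d2; clear - h; nra.
have dm1 : -1 < d by rewrite ltNge; apply/negP => h; move: d2; clear - h; nra.
have din : d \in `[(-1)%R, 1%R] by rewrite in_itv /= !ltW.
have ad : -1 <= d <= 1 by rewrite !ltW.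
have sd : sin (acos d) = `|cross u v|.
  rewrite sin_acos //; rewrite -sqrtr_sqr; congr (Num.sqrt _).
  by rewrite dE sqrrN -E addrK.
have a0 : 0 < acos d by apply: acos_gt0; rewrite d1 ltW.
have api : acos d < pi by apply: acos_ltpi; rewrite dm1 ltW.
have test : (0 < dot (normal S) v) && (0 < dot (normal S') (- u)) = (0 < cross u v).
  rewrite !dot_normal -/u -/v.
  have -> : cross v (- u) = cross u v by rewrite !coordE !mxE; ring.
  by rewrite andbb.
rewrite /th /seg_angle -/u -/v test.
case: ltP => [X_gt0|X_le0].
  rewrite -/d; split=> //.
  - by rewrite sd ger0_norm ?ltW.
  - by rewrite acosK.
  - by rewrite !ltNge (ltW api) (ltW X_gt0).
have X_lt0 : cross u v < 0 by rewrite lt_neqAle X0.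
rewrite -/d; split.
- by rewrite mulr_natl sinB sin2pi cos2pi sd ltr0_norm //; ring.
- by rewrite mulr_natl cosB sin2pi cos2pi acosK // dE; ring.
- by apply/negbTE; rewrite -leNgt; lra.
- by rewrite X_lt0; apply/idP; lra.
Qed.

(* [cross t x] is the signed distance from the origin of the line through [x]
   in the direction [t]. *)
Lemma length_from_heights (R : realType) (t0 t1 t2 v w : 'rV[R]_2) (l : R) :
  dot t1 t1 = 1 -> cross t0 t1 != 0 -> cross t1 t2 != 0 -> w = v + l *: t1 ->
  l = - (cross t0 v / cross t0 t1
         - cross t1 v * (dot t0 t1 / cross t0 t1 + dot t1 t2 / cross t1 t2)
         + cross t2 w / cross t1 t2).
Proof.
move=> u1 X1 X2 ->.
(* [v] is expanded in the orthonormal frame [t1], [rot90 t1]; inserting the factor [dot t1 t1 = 1]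
   makes these polynomial identities. *)
have E0 : cross t0 v = cross t0 t1 * dot v t1 + dot t0 t1 * cross t1 v.
  transitivity (dot t1 t1 * cross t0 v); first by rewrite u1 mul1r.
  by rewrite !coordE; ring.
have E2 : cross t2 (v + l *: t1) =
    - cross t1 t2 * (dot v t1 + l) + dot t1 t2 * cross t1 v.
  have -> : dot v t1 + l = dot v t1 + l * dot t1 t1 by rewrite u1 mulr1.
  transitivity (dot t1 t1 * cross t2 v + l * cross t2 t1 * dot t1 t1).
    by rewrite u1 mul1r mulr1 !coordE !mxE; ring.
  by rewrite !coordE; ring.
by rewrite E0 E2; field; rewrite X1 X2.
Qed.

Lemma eq_tangent_of_cross (R : realType) (u v : 'rV[R]_2) :
  dot u u = 1 -> dot v v = 1 -> cross u v = 0 -> v = u \/ v = - u.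
Proof.
move=> u1 v1 X0; have := cross_sqr u1 v1; rewrite X0 expr0n /= add0r => /eqP.
rewrite sqrf_eq1 => /orP[] /eqP d1; [left|right]; apply/eqP.
  rewrite -subr_eq0 -dotxx_eq0 !dotBr !(dotC (_ - _)) !dotBr u1 v1 (dotC v) d1.
  by apply/eqP; ring.
rewrite -subr_eq0 -dotxx_eq0 opprK !dotDr !(dotC (_ + _)) !dotDr u1 v1 (dotC v) d1.
by apply/eqP; ring.
Qed.

(** * Facets of the Wulff shape *)

Section facets.
Context (R : realType) (phi : 'rV[R]_2 -> R).
Hypothesis phi_anisotropy : anisotropy phi.

Lemma wulff_le_polar x y : wulff phi y -> dot y x <= polar phi x.
Proof.
have [_ _ _ [c [C [c0 cC cphi]]]] := phi_anisotropy.
move=> Wy; rewrite dotC; apply: ub_le_sup; last by exists y.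
(* The supremum needs an upper bound: [enorm z] is at most [c^-1] on the Wulff shape, and [dot x z]
   is at most [dot z z + dot x x]. *)
exists (c^-1 ^+ 2 + dot x x) => _ [z Wz <-].
have /andP[cz _] := cphi z.
have nz : enorm z <= c^-1.
  by rewrite -[c^-1]mul1r ler_pdivlMr // mulrC (le_trans cz).
have zz : dot z z <= c^-1 ^+ 2.
  by rewrite -[dot z z]sqr_sqrtr ?dotxx_ge0 // lerXn2r ?nnegrE ?sqrtr_ge0 // invr_ge0 ltW.
apply: le_trans (_ : dot z z + dot x x <= _); last by rewrite lerD2r.
have := dotxx_ge0 (x - z); have := dotxx_ge0 (x + z).
rewrite !dotE !mxE; nra.
Qed.

Lemma polar_gt0 x : dot x x = 1 -> 0 < polar phi x.
Proof.
have [_ _ _ [c [C [c0 cC cphi]]]] := phi_anisotropy.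
move=> x1; have C0 : 0 < C := lt_le_trans c0 cC.
have nx : enorm (C^-1 *: x) = C^-1.
  rewrite /enorm dotZr dotC dotZr x1 mulr1 -expr2 sqrtr_sqr ger0_norm //.
  by rewrite invr_ge0 ltW.
have W : wulff phi (C^-1 *: x).
  by have /andP[_] := cphi (C^-1 *: x); rewrite nx divff ?gt_eqF.
have := wulff_le_polar x W; rewrite dotC dotZr x1 mulr1; apply: lt_le_trans.
by rewrite invr_gt0.
Qed.

Lemma facet_mem F x : facet phi F -> x \in [:: F.1; F.2] ->
  wulff phi x /\ dot (normal F) x = polar phi (normal F).
Proof.
move=> [_ E]; rewrite !inE => xF.
suff : seg_set F x by rewrite E.
by case: F xF {E} => a b /= /orP[] /eqP ->; [exact: seg_set_left|exact: seg_set_right].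
Qed.

Lemma facet_fst F : facet phi F ->
  wulff phi F.1 /\ dot (normal F) F.1 = polar phi (normal F).
Proof. by move=> /facet_mem; apply; rewrite mem_head. Qed.

Lemma facet_snd F : facet phi F ->
  wulff phi F.2 /\ dot (normal F) F.2 = polar phi (normal F).
Proof. by move=> /facet_mem; apply; rewrite !inE eqxx orbT. Qed.

Lemma facet_tangent1 F : facet phi F -> dot (tangent F) (tangent F) = 1.
Proof. by case=> nd _; exact: dot_tangent. Qed.

Lemma facet_seglen_gt0 F : facet phi F -> 0 < seglen F.
Proof. by case=> nd _; exact: seglen_gt0. Qed.

(** From a point of the supporting line of [F], a move that ends in the Wulff shape cannot advance
    along the outward normal. *)
Lemma facet_cross_le0 F x t (r : R) : facet phi F ->
  dot (normal F) x = polar phi (normal F) -> 0 < r -> wulff phi (x + r *: t) ->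
  cross (tangent F) t <= 0.
Proof.
move=> fF xF r0 /(wulff_le_polar (normal F)).
by rewrite dotC dotDr xF dotZr gerDl pmulr_rle0.
Qed.

Lemma facet_cross_ge0 F x t (r : R) : facet phi F ->
  dot (normal F) x = polar phi (normal F) -> 0 < r -> wulff phi (x - r *: t) ->
  0 <= cross (tangent F) t.
Proof.
move=> fF xF r0; rewrite -scalerN => /(facet_cross_le0 fF xF r0).
by rewrite !crossE !mxE; lra.
Qed.

Lemma facet_fst_sub (F : segment R) : F.1 = F.2 - seglen F *: tangent F.
Proof. by rewrite (seg_endE F) addrK. Qed.

(** Opposite tangents would give [x] opposite pairings with the two normals, but both pairings are
    polar values, hence positive. *)
Lemma facet_tangent_unique F F' x : facet phi F -> facet phi F' ->
  cross (tangent F) (tangent F') = 0 ->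
  dot (normal F) x = polar phi (normal F) ->
  dot (normal F') x = polar phi (normal F') -> tangent F = tangent F'.
Proof.
move=> fF fF' X0 xF xF'.
have [//|opp] := eq_tangent_of_cross (facet_tangent1 fF) (facet_tangent1 fF') X0.
have p0 : 0 < polar phi (normal F) by apply: polar_gt0; rewrite dot_rot90 facet_tangent1.
have p0' : 0 < polar phi (normal F') by apply: polar_gt0; rewrite dot_rot90 facet_tangent1.
rewrite -xF in p0; rewrite -xF' in p0'.
have E : dot (normal F') x = - dot (normal F) x.
  by rewrite !dot_normal opp !crossE !mxE; ring.
by rewrite E oppr_gt0 ltNge (ltW p0) in p0'.
Qed.

(** Each facet lies on the inner side of the supporting line of the other, so their cross product is
    both nonpositive and nonnegative. *)
Lemma facet_same_start F F' : facet phi F -> facet phi F' -> F.1 = F'.1 ->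
  tangent F = tangent F'.
Proof.
move=> fF fF' E.
have [W1 e1] := facet_fst fF; have [W1' e1'] := facet_fst fF'.
have [W2 _] := facet_snd fF; have [W2' _] := facet_snd fF'.
apply: (@facet_tangent_unique F F' F.1) => //; last by rewrite E.
apply/eqP; rewrite eq_le; apply/andP; split.
  apply: (facet_cross_le0 fF e1 (facet_seglen_gt0 fF')).
  by rewrite E -seg_endE.
rewrite cross_antisym oppr_ge0.
apply: (facet_cross_le0 fF' e1' (facet_seglen_gt0 fF)).
by rewrite -E -seg_endE.
Qed.

Lemma facet_same_end F F' : facet phi F -> facet phi F' -> F.2 = F'.2 ->
  tangent F = tangent F'.
Proof.
move=> fF fF' E.
have [W1 e1] := facet_snd fF; have [W1' e1'] := facet_snd fF'.
have [W2 _] := facet_fst fF; have [W2' _] := facet_fst fF'.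
apply: (@facet_tangent_unique F F' F.2) => //; last by rewrite E.
apply/eqP; rewrite eq_le; apply/andP; split.
  rewrite cross_antisym oppr_le0.
  apply: (facet_cross_ge0 fF' e1' (facet_seglen_gt0 fF)).
  by rewrite -E -facet_fst_sub.
apply: (facet_cross_ge0 fF e1 (facet_seglen_gt0 fF')).
by rewrite E -facet_fst_sub.
Qed.

(** Facets run clockwise around the Wulff shape, their outward normals being on the left: a
    clockwise turn means that [F'] follows [F]. Sharing two starting points or two end points would
    make the tangents equal. *)
Lemma facet_adjacent F F' : facet phi F -> facet phi F' ->
  common_vertex F F' -> cross (tangent F) (tangent F') != 0 ->
  if cross (tangent F) (tangent F') < 0 then F.2 = F'.1 else F.1 = F'.2.
Proof.
move=> fF fF' [v []]; rewrite !inE => vF vF' X0.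
have nt : tangent F <> tangent F'.
  by move=> e; move: X0; rewrite e crossE mulrC subrr eqxx.
have [W1 e1] := facet_fst fF; have [W1' e1'] := facet_fst fF'.
have [W2 e2] := facet_snd fF; have [W2' e2'] := facet_snd fF'.
case/orP: vF => /eqP vF; case/orP: vF' => /eqP vF'; rewrite vF in vF'.
- by case: nt; exact: facet_same_start.
- case: ifP => // X_lt0; suff : 0 <= cross (tangent F) (tangent F') by rewrite leNgt X_lt0.
  apply: (facet_cross_ge0 fF e1 (facet_seglen_gt0 fF')).
  by rewrite vF' -facet_fst_sub.
- case: ifP => // X_lt0.
  suff : cross (tangent F) (tangent F') <= 0 by rewrite le_eqVlt (negbTE X0) X_lt0.
  apply: (facet_cross_le0 fF e2 (facet_seglen_gt0 fF')).
  by rewrite vF' -seg_endE.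
- by case: nt; exact: facet_same_end.
Qed.

End facets.

(** * Admissible curves *)

Section admissible_curve.
Context (R : realType) (phi : 'rV[R]_2 -> R) (G0 : curve R).
Hypothesis phi_anisotropy : anisotropy phi.
Hypothesis G0_admissible : admissible phi G0.

Let n := size G0.
Let tau i := tangent (seg G0 i).
(** [X i] and [D i] are the sine and minus the cosine of the angle between the segments [i - 1] and
    [i]; see [angleP]. *)
Let X i := cross (tau (prv G0 i)) (tau i).
Let D i := dot (tau (prv G0 i)) (tau i).
Let F i := facet_of phi (seg G0 i).
Let c := transition G0.

Lemma admissible_size_gt0 : (0 < n)%N.
Proof. by have [[]] := G0_admissible. Qed.

Lemma seg_prvS (G : curve R) i : (0 < size G)%N -> seg G (prv G i.+1) = seg G i.
Proof.
by move=> G_gt0; rewrite -[RHS]seg_mod -[LHS]seg_mod /prv addSnnS prednK // modnDr.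
Qed.

Lemma seg_prv_mod i : seg G0 (prv G0 (i %% n)) = seg G0 (prv G0 i).
Proof. by rewrite -[RHS]seg_mod -[LHS]seg_mod /prv modnDml. Qed.

Lemma seg_nondegenerate i : ~ degenerate (seg G0 i).
Proof.
have [[n0 H] _ _] := G0_admissible; rewrite -seg_mod.
by have [] := H (i %% n)%N; rewrite // ltn_mod.
Qed.

Lemma tau_unit i : dot (tau i) (tau i) = 1.
Proof. exact/dot_tangent/seg_nondegenerate. Qed.

Lemma tau_prvS i : tau (prv G0 i.+1) = tau i.
Proof. by rewrite /tau seg_prvS // admissible_size_gt0. Qed.

Lemma cross_tauS_neq0 i : cross (tau i) (tau i.+1) != 0.
Proof.
have [[n0 H] _ _] := G0_admissible.
have [|_] := H (i %% n)%N; first by rewrite ltn_mod.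
rewrite seg_mod (_ : seg G0 (i %% n).+1 = seg G0 i.+1); last first.
  by rewrite -[RHS]seg_mod -[LHS]seg_mod -addn1 modnDml addn1.
move=> npar; apply/eqP => X0; apply: npar; rewrite /parallel_seg.
rewrite (seg_endE (seg G0 i.+1)) [_ + _ *: _]addrC addrK dotZr dot_normal.
  by rewrite -/(tau i) -/(tau i.+1) X0 mulr0.
Qed.

Lemma tau_prv_prvS i : tau (prv G0 i).+1 = tau i.
Proof.
rewrite /tau -[seg G0 i]seg_mod -[seg _ (_.+1)]seg_mod /prv -addnS prednK ?admissible_size_gt0 //.
by rewrite modnDr.
Qed.

Lemma X_neq0 i : X i != 0.
Proof. by rewrite /X -(tau_prv_prvS i) cross_tauS_neq0. Qed.

Lemma X_cases i : (X i < 0) = true /\ (0 < X i) = false \/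
  (X i < 0) = false /\ (0 < X i) = true.
Proof.
have := X_neq0 i; rewrite neq_lt => /orP[] X0; [left|right].
  by rewrite X0; split=> //; apply: lt_gtF.
by rewrite X0; split=> //; apply: lt_gtF.
Qed.

Lemma angleP i : [/\ sin (angle G0 i) = X i, cos (angle G0 i) = - D i,
  (angle G0 i < pi) = (0 < X i) & (pi < angle G0 i) = (X i < 0)].
Proof. by apply: seg_angleP; [exact: tau_unit|exact: tau_unit|exact: X_neq0]. Qed.

Lemma cot_angle i : cot (angle G0 i) = - (D i / X i).
Proof. by have [sE cE _ _] := angleP i; rewrite /cot sE cE mulNr. Qed.

Lemma transitionE i : c i =
  if (X i < 0) && (X i.+1 < 0) then 1 else if (0 < X i) && (0 < X i.+1) then - 1 else 0.
Proof.
have [_ _ l1 g1] := angleP i; have [_ _ l2 g2] := angleP i.+1.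
by rewrite /c /transition l1 g1 l2 g2.
Qed.

Lemma facet_ofP i : facet phi (F i) /\ tangent (F i) = tau i.
Proof.
have [_ H _] := G0_admissible.
have : exists S, (facet phi S /\ normal S = normal (seg G0 i)).
  have [|S] := H (i %% n)%N; first by rewrite ltn_mod admissible_size_gt0.
  by rewrite seg_mod; exists S.
move=> /getPex [fF nF]; split=> //; exact: tangent_of_normal.
Qed.

Lemma normal_facet_of i : normal (F i) = normal (seg G0 i).
Proof. by have [_ e] := facet_ofP i; rewrite /normal e. Qed.

Lemma common_vertex_prv i : common_vertex (F (prv G0 i)) (F i).
Proof.
have [_ _ H] := G0_admissible.
have := H (i %% n)%N; rewrite ltn_mod admissible_size_gt0 => /(_ isT).
by rewrite /F seg_mod seg_prv_mod.
Qed.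

Lemma facet_adjacent_prv i :
  if X i < 0 then (F (prv G0 i)).2 = (F i).1 else (F (prv G0 i)).1 = (F i).2.
Proof.
have [fF tF] := facet_ofP i; have [fF' tF'] := facet_ofP (prv G0 i).
have cv := common_vertex_prv i.
have := facet_adjacent phi_anisotropy fF' fF cv; rewrite tF tF' -/(X i).
by apply; exact: X_neq0.
Qed.

Lemma F_prvS i : F (prv G0 i.+1) = F i.
Proof. by rewrite /F seg_prvS // admissible_size_gt0. Qed.

(** When the turns at the two ends have opposite signs, the facets of both neighbours end, or both
    start, at the same vertex of [F i], which forces equal tangents. *)
Lemma tau_of_transition_eq0 i : c i = 0 -> tau (prv G0 i) = tau i.+1.
Proof.
move=> ci; have [fF tF] := facet_ofP (prv G0 i); have [fF' tF'] := facet_ofP i.+1.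
have := facet_adjacent_prv i; have := facet_adjacent_prv i.+1; rewrite F_prvS.
move: ci; rewrite transitionE -tF -tF'.
case: (X_cases i) => -[-> ->]; case: (X_cases i.+1) => -[-> ->] /=.
- by move=> e; exfalso; exact: (elimF eqP (oner_eq0 R) e).
- by move=> _ e e'; apply: (facet_same_end phi_anisotropy fF fF'); rewrite e' -e.
- by move=> _ e e'; apply: (facet_same_start phi_anisotropy fF fF'); rewrite e' -e.
- by move=> /eqP e; exfalso; move: e; rewrite oppr_eq0 (oner_eq0 R).
Qed.

Lemma polar_normal_gt0 i : 0 < polar phi (normal (seg G0 i)).
Proof. by apply: polar_gt0 => //; rewrite dot_rot90 tau_unit. Qed.

Lemma facet_len_gt0 i : 0 < facet_len phi G0 i.
Proof. by apply: (@facet_seglen_gt0 _ phi); exact: (facet_ofP i).1. Qed.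

Lemma delta_gt0 i : 0 < delta phi G0 i.
Proof. by rewrite mulr_gt0 ?exprn_gt0 ?facet_len_gt0 ?polar_normal_gt0. Qed.

Let K i := cot (angle G0 i) + cot (angle G0 i.+1).

Lemma KE i : K i = - (D i / X i + D i.+1 / X i.+1).
Proof. by rewrite /K !cot_angle; ring. Qed.

Lemma K_of_transition_eq0 i : c i = 0 -> K i = 0.
Proof.
move=> ci; rewrite KE /D /X tau_prvS (tau_of_transition_eq0 ci).
by rewrite dotC cross_antisym invrN; ring.
Qed.

(* The vertices shared by consecutive facets form a closed polygon whose
   [i]-th edge has signed length [c i * facet_len i]. *)
Lemma transition_facet_len i :
  c i * facet_len phi G0 i =
  - (polar phi (normal (seg G0 (prv G0 i))) / X i
     + K i * polar phi (normal (seg G0 i))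
     + polar phi (normal (seg G0 i.+1)) / X i.+1).
Proof.
have [fp tp] := facet_ofP (prv G0 i); have [fi ti] := facet_ofP i.
have [fs ts] := facet_ofP i.+1.
have [_ p1] := facet_fst fp; have [_ p2] := facet_snd fp.
have [_ i1] := facet_fst fi; have [_ i2] := facet_snd fi.
have [_ s1] := facet_fst fs; have [_ s2] := facet_snd fs.
have := facet_adjacent_prv i; have := facet_adjacent_prv i.+1; rewrite F_prvS.
(* [v] is the vertex that [F i] shares with the facet of the previous segment, and [w] the one
   shared with the facet of the next. *)
pose v := if X i < 0 then (F i).1 else (F i).2.
pose w := if X i.+1 < 0 then (F i).2 else (F i).1.
move=> adjs adji.
have vp : cross (tau (prv G0 i)) v = polar phi (normal (seg G0 (prv G0 i))).
  rewrite -tp -dot_normal -normal_facet_of /v.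
  by move: adji; case: ifP => _ <-.
have vi : cross (tau i) v = polar phi (normal (seg G0 i)).
  by rewrite -ti -dot_normal -normal_facet_of /v; case: ifP.
have ws : cross (tau i.+1) w = polar phi (normal (seg G0 i.+1)).
  rewrite -ts -dot_normal -normal_facet_of /w.
  by move: adjs; case: ifP => _ ->.
have wv : w = v + (c i * facet_len phi G0 i) *: tau i.
  have e := seg_endE (F i); have e' := facet_fst_sub (F i).
  rewrite -/(facet_len phi G0 i) ti in e e'.
  rewrite /w /v transitionE.
  case: (X_cases i) => -[-> ->]; case: (X_cases i.+1) => -[-> ->] /=.
  - by rewrite mul1r.
  - by rewrite mul0r scale0r addr0.
  - by rewrite mul0r scale0r addr0.
  - by rewrite mulN1r scaleNr.
have X2 : cross (tau i) (tau i.+1) != 0 by exact: cross_tauS_neq0.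
have -> := length_from_heights (tau_unit i) (X_neq0 i) X2 wv.
by rewrite vp vi ws KE /X /D tau_prvS; ring.
Qed.

(** The entries are sums of indicators, so that contributions add up when the neighbours of [i]
    coincide, as for two segments. *)
Definition curve_matrix : 'M[R]_n := \matrix_(i, j)
  ((j == ord_pred i)%:R / X i + (j == i)%:R * K i + (j == ordS i)%:R / X i.+1).

Lemma X_mod i : X (i %% n) = X i.
Proof. by rewrite /X /tau seg_mod seg_prv_mod. Qed.

Lemma curve_matrix_sym (i j : 'I_n) : curve_matrix i j = curve_matrix j i.
Proof.
have XS (a b : 'I_n) : (a == ordS b)%:R / X b.+1 = (b == ord_pred a)%:R / X a.
  have [->|ne] := eqVneq a (ordS b).
    by rewrite ordSK eqxx /= X_mod.
  by rewrite (_ : (b == _) = false) ?mul0r //; apply/eqP => e; rewrite e ord_predK eqxx in ne.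
rewrite !mxE (XS i j) -(XS j i) [i == j]eq_sym.
have [->|_] := eqVneq j i; first by ring.
by rewrite !mul0r !addr0 addrC.
Qed.

Lemma curve_matrixE (i : 'I_n) (y : nat -> R) : (forall j, y (j %% n)%N = y j) ->
  \sum_j curve_matrix i j * y j = y (prv G0 i) / X i + K i * y i + y i.+1 / X i.+1.
Proof.
move=> yn; under eq_bigr do rewrite mxE !mulrDl.
have delta (k : 'I_n) (z : R) : \sum_(j < n) (j == k)%:R * z * y j = z * y k.
  rewrite (bigD1 k) //= eqxx mul1r big1 ?addr0 // => j /negbTE ->.
  by rewrite !mul0r.
rewrite !big_split /= !delta; congr (_ + _ + _); rewrite mulrC; congr (_ / _).
  rewrite -[LHS]yn /= modn_mod -[RHS]yn /prv; congr (y (_ %% _)%N).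
  by have := admissible_size_gt0; rewrite /n; lia.
by rewrite -[RHS]yn.
Qed.

Lemma transition_mod i : c (i %% n) = c i.
Proof.
rewrite !transitionE X_mod; suff -> : X (i %% n).+1 = X i.+1 by [].
by rewrite -X_mod -[RHS]X_mod -addn1 modnDml addn1.
Qed.

Lemma delta_mod i : delta phi G0 (i %% n) = delta phi G0 i.
Proof. by rewrite /delta /facet_len seg_mod. Qed.

Lemma elastic_termE (i : 'I_n) (l : nat -> R) : (forall j, l (j %% n)%N = l j) ->
  elastic_term phi G0 l i =
  \sum_j curve_matrix i j * (c j ^+ 2 * delta phi G0 j / l j ^+ 2).
Proof.
move=> ln; rewrite (@curve_matrixE _ (fun j => c j ^+ 2 * delta phi G0 j / l j ^+ 2)).
  have [s1 _ _ _] := angleP i; have [s2 _ _ _] := angleP i.+1.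
  have frac1 (x d y z : R) : x ^+ 2 * d / (y ^+ 2 * z) = x ^+ 2 * d / y ^+ 2 / z.
    by rewrite invfM mulrA.
  have frac2 (x d y z : R) : x ^+ 2 * d * z / y ^+ 2 = z * (x ^+ 2 * d / y ^+ 2) by ring.
  rewrite /elastic_term s1 s2.
  congr (_ + _ + _).
  - exact: frac1.
  - exact: frac2.
  - exact: frac1.
by move=> j; rewrite ln transition_mod delta_mod.
Qed.

Lemma modn_prv i : (prv G0 i.+1 %% n = i %% n)%N.
Proof. by rewrite /prv addSnnS prednK ?admissible_size_gt0 // modnDr. Qed.

Lemma elastic_term_mod (l : nat -> R) i : (forall j, l (j %% n)%N = l j) ->
  elastic_term phi G0 l (i %% n) = elastic_term phi G0 l i.
Proof.
move=> ln.
have pm (f : nat -> R) : (forall j, f (j %% n)%N = f j) ->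
    f (prv G0 (i %% n)) = f (prv G0 i).
  by move=> fn; rewrite -[RHS]fn -[LHS]fn /prv modnDml.
have sm (f : nat -> R) : (forall j, f (j %% n)%N = f j) -> f (i %% n).+1 = f i.+1.
  by move=> fn; rewrite -[RHS]fn -[LHS]fn -addn1 modnDml addn1.
have am j : angle G0 (j %% n) = angle G0 j by rewrite /angle seg_mod seg_prv_mod.
rewrite /elastic_term -/c (pm _ transition_mod) (pm _ delta_mod) (pm _ ln) (sm _ transition_mod).
by rewrite (sm _ delta_mod) (sm _ ln) (sm _ am) am ln delta_mod transition_mod.
Qed.

(** This allows the meaningless limits attached to zero transition numbers to be replaced by actual
    limit lengths. *)
Lemma eq_elastic_term (l l' : nat -> R) i : (forall j, c j != 0 -> l j = l' j) ->
  elastic_term phi G0 l i = elastic_term phi G0 l' i.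
Proof.
move=> ll'; rewrite /elastic_term -/c.
have eqc j (x y z k : R) : (c j != 0 -> x = y) ->
    c j ^+ 2 * z * x = c j ^+ 2 * z * y /\ c j ^+ 2 * z * k * x = c j ^+ 2 * z * k * y.
  by have [->|cj /(_ isT) ->//] := eqVneq (c j) 0; rewrite expr0n /= !mul0r.
congr (_ + _ + _).
- by apply: (eqc _ _ _ _ 0 _).1 => /ll' ->.
- by apply: (eqc _ _ _ _ _ _).2 => /ll' ->.
- by apply: (eqc _ _ _ _ 0 _).1 => /ll' ->.
Qed.

End admissible_curve.

(** * The flow after its last restart *)

Lemma elastic_flow_after_restarts (R : realType) (phi : 'rV[R]_2 -> R) (alpha : R)
    (G : R -> curve R) (T : R) (n : nat) :
  elastic_flow_restarts phi alpha G -> 0 < T ->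
  (forall t : R, T <= t -> size (G t) = n) ->
  exists t0 : R, [/\ 0 <= t0, t0 <= T, admissible phi (G t0) &
    elastic_flow phi alpha (G t0) +oo%E (fun s => G (t0 + s))].
Proof.
move=> [[K [tau [tau0 tauS fl rs]]] _] T0 sizeG.
have tau_ge0 k : (k <= K)%N -> 0 <= tau k.
  elim: k => [|k IH] kK; first by rewrite tau0.
  by rewrite (le_trans (IH (ltnW kK))) // ltW // tauS.
have [tT|Tt] := leP (tau K) T.
  exists (tau K); have [aK fK] := fl K (leqnn K).
  by rewrite ltnn in fK; split=> //; exact: tau_ge0.
(* Suppose the last restart occurs after [T]. It strictly lowers the number of segments, which is
   constant from [T] on. *)
case: K tauS fl rs tau_ge0 Tt => [|k] tauS fl rs tau_ge0 Tt.
  by move: Tt; rewrite tau0 ltNge ltW.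
have [P [sP _ [i iP di] _ PG]] := rs k (ltnSn k).
have [aK _] := fl k.+1 (leqnn _).
have lt1 : (size (G (tau k.+1)) < size P)%N.
  apply: size_collapse_degenerate PG _ _; first by exists i.
  by move=> j; exact: seg_nondegenerate aK j.
have [_ [_ par _]] := fl k (leqnSn k).
rewrite ltnSn in par.
(* This is a time past [T] but before the last restart, so [G t] still has as many segments as
   [G (tau k)]. *)
pose t := Num.max T (tau k).
have tk : tau k <= t by rewrite le_max lexx orbT.
have Tt' : T <= t by rewrite le_max lexx.
have tk1 : t < tau k.+1 by rewrite gt_max Tt tauS.
have [] := par (t - tau k); first by rewrite subr_ge0.
  by rewrite lte_fin ltrD2r.
rewrite addrC subrK sizeG // => nE _.
by move: lt1; rewrite sP -nE sizeG ?ltnn // ltW.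
Qed.

(** * Convergence of the flow *)

Lemma cross_cramer (R : realType) (u v x : 'rV[R]_2) :
  cross u v *: x = cross u x *: v - cross v x *: u.
Proof. by apply: row2P; rewrite !mxE !crossE; ring. Qed.

Lemma eq_normal_facet_of (R : realType) (phi : 'rV[R]_2 -> R) (S S' : segment R) :
  normal S = normal S' -> facet_of phi S = facet_of phi S'.
Proof. by rewrite /facet_of => ->. Qed.

Lemma eq_normal_seg_angle (R : realType) (S1 S2 S1' S2' : segment R) :
  normal S1 = normal S1' -> normal S2 = normal S2' -> seg_angle S1 S2 = seg_angle S1' S2'.
Proof.
by move=> e1 e2; rewrite /seg_angle e1 e2 (tangent_of_normal e1) (tangent_of_normal e2).
Qed.

Section eq_normals.
Context (R : realType) (phi : 'rV[R]_2 -> R) (G G' : curve R).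
Hypothesis eq_size : size G = size G'.
Hypothesis eq_normal : forall i, normal (seg G i) = normal (seg G' i).

(** Angles, and through them transition numbers, depend on the normals only. This transfers the
    limit equations from the initial curve of the last flow to [G T]. *)
Lemma eq_normal_angle : angle G = angle G'.
Proof.
apply/funext => i; apply: eq_normal_seg_angle => //.
by rewrite /prv eq_size.
Qed.

Lemma eq_normal_transition : transition G = transition G'.
Proof. by rewrite /transition eq_normal_angle. Qed.

Lemma eq_normal_facet_len : facet_len phi G = facet_len phi G'.
Proof.
by apply/funext => i; rewrite /facet_len (eq_normal_facet_of phi (eq_normal i)).
Qed.

Lemma eq_normal_elastic_term : elastic_term phi G = elastic_term phi G'.
Proof.
have dE : delta phi G = delta phi G'.
  by apply/funext => i; rewrite /delta eq_normal_facet_len eq_normal.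
rewrite /elastic_term eq_normal_transition dE eq_normal_angle.
by apply/funext => l; apply/funext => i; rewrite /prv eq_size.
Qed.

End eq_normals.

Lemma parallel_curve_normal (R : realType) (G0 G : curve R) : (0 < size G0)%N ->
  parallel_curve G0 G -> forall i, normal (seg G i) = normal (seg G0 i).
Proof.
move=> G0_gt0 [sz par] i; rewrite -seg_mod -[in RHS]seg_mod sz.
by have [|_ _ ->] := par (i %% size G0)%N; first by rewrite ltn_mod.
Qed.

Section flow_convergence.
Context (R : realType) (phi : 'rV[R]_2 -> R) (alpha : R) (G0 : curve R) (G : R -> curve R).
Hypothesis phi_anisotropy : anisotropy phi.
Hypothesis G0_admissible : admissible phi G0.
Hypothesis alpha_gt0 : 0 < alpha.
Hypothesis G_flow : elastic_flow phi alpha G0 +oo%E G.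

Let n := size G0.
Let n_gt0 : (0 < n)%N := admissible_size_gt0 G0_admissible.
Let tau i := tangent (seg G0 i).
Let c := transition G0.
Let v i (t : R) := vtx (G t) i.
Let L i (t : R) := seglen (seg (G t) i).
Let h i (t : R) := cross (tau i) (v i t).
Let X i := cross (tau (prv G0 i)) (tau i).
Let K i := cot (angle G0 i) + cot (angle G0 i.+1).

Lemma G_parallel (t : R) : 0 <= t -> parallel_curve G0 (G t).
Proof. by move=> t0; have [_ par _] := G_flow; apply: par => //; exact: ltry. Qed.

Lemma size_Gt (t : R) : 0 <= t -> size (G t) = n.
Proof. by move=> /G_parallel[]. Qed.

Lemma tangent_Gt i (t : R) : 0 <= t -> tangent (seg (G t) i) = tau i.
Proof.
by move=> /G_parallel par; exact/tangent_of_normal/(parallel_curve_normal n_gt0 par).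
Qed.

Lemma L_gt0 i (t : R) : 0 <= t -> 0 < L i t.
Proof.
move=> t0; have [sz par] := G_parallel t0; apply: seglen_gt0.
rewrite -seg_mod sz.
by have [|//] := par (i %% size G0)%N; first by rewrite ltn_mod.
Qed.

Lemma v_mod i (t : R) : 0 <= t -> v (i %% n) t = v i t.
Proof. by move=> t0; rewrite /v -vtx_mod -[RHS]vtx_mod size_Gt // modn_mod. Qed.

Lemma L_mod i (t : R) : 0 <= t -> L (i %% n) t = L i t.
Proof. by move=> t0; rewrite /L -(size_Gt t0) seg_mod. Qed.

Lemma tau_mod i : tau (i %% n) = tau i.
Proof. by rewrite /tau seg_mod. Qed.

Lemma h_mod i (t : R) : 0 <= t -> h (i %% n) t = h i t.
Proof. by move=> t0; rewrite /h tau_mod v_mod. Qed.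

Lemma vS i (t : R) : 0 <= t -> v i.+1 t = v i t + L i t *: tau i.
Proof. by move=> t0; rewrite -(tangent_Gt i t0); exact: (seg_endE (seg (G t) i)). Qed.

Lemma hS i (t : R) : 0 <= t -> cross (tau i) (v i.+1 t) = h i t.
Proof.
move=> t0; rewrite vS // /h /cross dotDr dotZr -/(cross (tau i) (tau i)).
by rewrite (_ : cross _ (tau i) = 0) ?mulr0 ?addr0 // crossE; ring.
Qed.

Lemma v_prv_S i (t : R) : 0 <= t -> v (prv G0 i).+1 t = v i t.
Proof.
move=> t0; rewrite -v_mod // -[RHS]v_mod //; congr (v _ t).
by rewrite /prv -addnS prednK // modnDr.
Qed.

Lemma L_heights i (t : R) : 0 <= t ->
  L i t = - (h (prv G0 i) t / X i + K i * h i t + h i.+1 t / X i.+1).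
Proof.
move=> t0; rewrite [LHS](length_from_heights (tau_unit G0_admissible i)
  (X_neq0 G0_admissible i) (cross_tauS_neq0 G0_admissible i) (vS i t0)).
rewrite -/(tau i) -/(tau (prv G0 i)) -/(tau i.+1).
rewrite -{1}(v_prv_S i t0) hS // -/(X i) -/(h i t) -/(h i.+1 t).
rewrite /K (KE G0_admissible) -/(tau i) -/(tau (prv G0 i)) -/(X i).
by rewrite /X /tau !(tau_prvS G0_admissible); ring.
Qed.

Let A := curve_matrix G0.
Let b i := c i * facet_len phi G0 i.
Let w i := alpha * (c i ^+ 2 * delta phi G0 i).
Let pol i := polar phi (normal (seg G0 i)).

Lemma L_matrix (i : 'I_n) (t : R) : 0 <= t -> L i t = - \sum_j A i j * h j t.
Proof.
by move=> t0; rewrite (curve_matrixE G0_admissible _ (fun j => h_mod j t0)) -L_heights.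
Qed.

Lemma elastic_matrix (i : 'I_n) (l : nat -> R) : (forall j, l (j %% n)%N = l j) ->
  alpha * elastic_term phi G0 l i = \sum_j A i j * (w j / l j ^+ 2).
Proof.
move=> ln; rewrite (elastic_termE G0_admissible _ ln) mulr_sumr.
by apply: eq_bigr => j _; rewrite mulrCA; congr (_ * _); exact: mulrA.
Qed.

(** The height relative to [G0] and [h] differ by a constant in time, so they have the same
    derivative. *)
Lemma height_cross i (t : R) : height G0 G i t = h i t - cross (tau i) (vtx G0 i).
Proof.
rewrite /height /hvec [dot (_ *: _) _]dotC dotZr dot_rot90 (tau_unit G0_admissible) mulr1.
by rewrite dotC dotBr.
Qed.

Lemma flow_equation (i : 'I_n) (t : R) : 0 < t -> exists dh,
  is_derive t (1 : R) (h i) dh /\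
  L i t * dh = - (pol i * (b i + \sum_j A i j * (w j / L j t ^+ 2))).
Proof.
move=> t0; have t0' := ltW t0.
have [_ _ fl] := G_flow.
have [_ _ /(_ t t0 (ltry t))] := fl i (ltn_ord i).
rewrite derive1E => -[dv _ E].
exists ('D_1 (height G0 G i) t); split.
  have D := is_deriveD (DeriveDef dv erefl)
     (is_derive_cst (cross (tau i) (vtx G0 i)) t (1 : R)).
  have -> : h i = height G0 G i + cst (cross (tau i) (vtx G0 i)).
    by apply/funext => s; rewrite -[(_ + _) s]/(_ s + _ s) /= height_cross subrK.
  by apply: is_derive_eq D _; rewrite addr0.
rewrite -(elastic_matrix _ (fun j => L_mod j t0')).
have p0 : pol i != 0 by rewrite gt_eqF // polar_normal_gt0.
have l0 : L i t != 0 by rewrite gt_eqF // L_gt0.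
have key (a l q e k : R) : l != 0 ->
  l * ((- (k / l) - a / l * e) * q) = - (q * (k + a * e)).
  by move=> ?; field.
by rewrite (canRL (divfK p0) E); exact: key.
Qed.

Lemma flow_gradient_converges : exists lam : 'I_n -> R,
  [/\ forall j : 'I_n, c j != 0 -> 0 < lam j /\ L j t @[t --> +oo] --> lam j,
      forall i : 'I_n, b i + \sum_j A i j * (w j / lam j ^+ 2) = 0
    & forall (i : 'I_n) (e t0 : R), 0 < e -> (forall t, t0 <= t -> e <= L i t) ->
        cvg (h i t @[t --> +oo])].
Proof.
have /choice[dh' Hdh'] : forall it : 'I_n * R, exists dh, 0 < it.2 ->
  is_derive it.2 (1 : R) (h it.1) dh /\
  L it.1 it.2 * dh = - (pol it.1 * (b it.1 + \sum_j A it.1 j * (w j / L j it.2 ^+ 2))).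
  move=> [i t] /=; have [t0|_] := boolP (0 < t); last by exists 0.
  by have [dh ?] := flow_equation i t0; exists dh.
(* The abstract flow defines its lengths as minus the matrix applied to the heights; this agrees
   with [L] only at nonnegative times. *)
have LE (i : 'I_n) (t : R) : 0 <= t -> - (\sum_j A i j * h j t) = L i t.
  by move=> t0; rewrite L_matrix.
have wneq (j : 'I_n) : (w j != 0) = (c j != 0).
  have d0 := delta_gt0 phi_anisotropy G0_admissible j.
  by rewrite /w mulf_eq0 (gt_eqF alpha_gt0) mulf_eq0 sqrf_eq0 (gt_eqF d0) orbF.
have [| | | | | | |lam [lam1 lam2 lam3]] := @gradient_flow_converges R n A
  (fun i : 'I_n => pol i) (fun i : 'I_n => b i) (fun i : 'I_n => w i)
  (fun i : 'I_n => h i) (fun i t => dh' (i, t)).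
- exact: curve_matrix_sym.
- by move=> i; exact: polar_normal_gt0.
- move=> i; rewrite mulr_ge0 ?(ltW alpha_gt0) // mulr_ge0 ?sqr_ge0 //.
  by rewrite ltW // (delta_gt0 phi_anisotropy G0_admissible).
- move=> i; rewrite (curve_matrixE G0_admissible i (y := pol)); last first.
    by move=> j; rewrite /pol seg_mod.
  exact: transition_facet_len.
- by move=> i t t0; rewrite LE // L_gt0.
- by move=> i t t0; have [] := Hdh' (i, t) t0.
- move=> i t t0; rewrite LE ?(ltW t0) //; have [_ ->] := Hdh' (i, t) t0.
  by under [in RHS]eq_bigr do rewrite LE ?(ltW t0) //.
have Lnear (i : 'I_n) : \forall t \near +oo, - (\sum_j A i j * h j t) = L i t.
  by near=> t; apply: LE; near: t; apply: nbhs_pinfty_ge; rewrite num_real.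
exists lam; split=> //.
- move=> j cj; have [|l0 lc] := lam1 j; first by rewrite wneq.
  by split=> //; apply: cvg_trans lc; apply: near_eq_cvg; exact: Lnear.
- move=> i e t0 e0 He; apply: (lam3 i e (Num.max 0 t0) e0) => t.
  by rewrite ge_max => /andP[tp tt]; rewrite LE // He.
Unshelve. all: by end_near. Qed.

Lemma sum_edges (t : R) : 0 <= t -> \sum_(i < n) L i t *: tau i = 0.
Proof.
move=> t0; have -> : \sum_(i < n) L i t *: tau i = \sum_(0 <= i < n) (v i.+1 t - v i t).
  by rewrite big_mkord; apply: eq_bigr => i _; rewrite vS // [v i t + _]addrC addrK.
by rewrite (telescope_sumr (fun i => v i t)) // -(v_mod n t0) modnn subrr.
Qed.

(** Otherwise the tangents alternate between two non-parallel directions. In the direction normal to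
    the first, all edges then contribute with one sign, and edge 1 strictly, so the curve cannot
    close. *)
Lemma exists_curved_edge : exists i, c i != 0.
Proof.
apply: contrapT => nc.
have c0 i : c i = 0 by apply/eqP/negPn/negP => ci; apply: nc; exists i.
have alt i : tau i.+2 = tau i.
  have := tau_of_transition_eq0 phi_anisotropy G0_admissible (c0 i.+1).
  by rewrite (tau_prvS G0_admissible).
pose Y := cross (tau 0%N) (tau 1%N).
have crossY i : cross (tau 0%N) (tau i) = (odd i)%:R * Y.
  suff : cross (tau 0%N) (tau i) = (odd i)%:R * Y /\
         cross (tau 0%N) (tau i.+1) = (odd i.+1)%:R * Y by case.
  elim: i => [|i [IH1 IH2]].
    by rewrite /= mul0r mul1r; split=> //; rewrite crossE; ring.
  by split=> //; rewrite alt IH1 /= negbK.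
have Y0 : Y != 0 by exact: cross_tauS_neq0 G0_admissible 0%N.
have n1 : (1 < n)%N.
  rewrite ltn_neqAle n_gt0 andbT; apply/eqP => n1; move: Y0.
  by rewrite /Y -[tau 1%N]tau_mod -n1 crossE mulrC subrr eqxx.
have := congr1 (fun x => Y * cross (tau 0%N) x) (sum_edges (lexx 0)).
rewrite /cross dot_sumr -/(cross (tau 0%N) 0) (_ : cross _ 0 = 0); last first.
  by rewrite crossE !mxE; ring.
rewrite mulr0 mulr_sumr => /eqP; apply/negP; rewrite gt_eqF //.
have T i : Y * dot (rot90 (tau 0%N)) (L i 0 *: tau i) = L i 0 * ((odd i)%:R * Y ^+ 2).
  by rewrite dotZr -/(cross (tau 0%N) (tau i)) crossY; ring.
rewrite (bigD1 (Ordinal n1)) //= T /= mul1r ltr_pwDl //.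
  by rewrite mulr_gt0 ?L_gt0 // lt_def sqr_ge0 sqrf_eq0 Y0.
apply: sumr_ge0 => i _; rewrite T mulr_ge0 ?(ltW (L_gt0 _ _)) //.
by rewrite mulr_ge0 ?sqr_ge0.
Qed.

Lemma flow_limit : exists (V : nat -> 'rV[R]_2) (lam : nat -> R),
  [/\ closed_chain (fun x y => exists i, x = tau i /\ y = tau i.+1) n V tau lam,
      forall i, v i t @[t --> +oo] --> V i,
      forall i, L i t @[t --> +oo] --> lam i,
      forall i, lam i = 0 -> c i = 0
    & forall i, b i + alpha * elastic_term phi G0 lam i = 0].
Proof.
have [lam0 [lam0P crit hcvg]] := flow_gradient_converges.
have near_ge0 : \forall t \near +oo, (0 : R) <= t.
  by apply: nbhs_pinfty_ge; rewrite num_real.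
have c_mod i : c (i %% n)%N = c i := transition_mod G0_admissible i.
pose o i : 'I_n := Ordinal (ltn_pmod i n_gt0).
have Lo i : \forall t \near +oo, L (o i) t = L i t.
  by apply: filterS near_ge0 => t t0; rewrite /= L_mod.
have ho i : \forall t \near +oo, h (o i) t = h i t.
  by apply: filterS near_ge0 => t t0; rewrite /= h_mod.
pose lam1 i := lam0 (o i).
have lam1P i : c i != 0 -> 0 < lam1 i /\ L i t @[t --> +oo] --> lam1 i.
  move=> ci; have [|l0 lc] := lam0P (o i); first by rewrite /= c_mod.
  by split=> //; apply: cvg_trans lc; apply: near_eq_cvg; exact: Lo.
have lam1_mod i : lam1 (i %% n)%N = lam1 i.
  by congr lam0; apply: val_inj; rewrite /= modn_mod.
have crit1 i : b i + alpha * elastic_term phi G0 lam1 i = 0.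
  have E := crit (o i).
  have S : \sum_j A (o i) j * (w j / lam0 j ^+ 2) = \sum_j A (o i) j * (w j / lam1 j ^+ 2).
    apply: eq_bigr => j _; congr (_ * (_ / _ ^+ 2)); congr lam0.
    by apply: val_inj; rewrite /= modn_small.
  rewrite S -(elastic_matrix (o i) lam1_mod) in E.
  have eb : b (o i) = b i by rewrite /b /= c_mod /facet_len seg_mod.
  have ee := elastic_term_mod G0_admissible i lam1_mod.
  by rewrite eb ee in E.
have hcvg1 i (l : R) : 0 < l -> L i t @[t --> +oo] --> l -> cvg (h i t @[t --> +oo]).
  move=> l0 lc; have /= : \forall t \near +oo, l / 2 <= L (o i) t.
    have h2 : \forall t \near +oo, l / 2 <= L i t.
      by apply: (cvgr_ge l lc); lra.
    by apply: filterS2 h2 (Lo i) => t ? ->.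
  move=> [M [_ HM]].
  have /cvg_ex[x hx] : cvg (h (o i) t @[t --> +oo]).
    apply: (hcvg (o i) (l / 2) (M + 1)); first lra.
    by move=> t Mt; apply: HM; apply: lt_le_trans Mt; rewrite ltrDl.
  by apply/cvg_ex; exists x; apply: cvg_trans hx; apply: near_eq_cvg; exact: ho.
(* In the limit equation of the segment [i.+1], only the term with [c i.+2] could survive, and its
   other factors are nonzero. *)
have crit_succ i : c i = 0 -> c i.+1 = 0 -> c i.+2 = 0.
  move=> c1 c2; apply/eqP/negPn/negP => c3; have := crit1 i.+1.
  rewrite /b c2 mul0r add0r => /eqP; apply/negP.
  have cp : c (prv G0 i.+1) = 0 by rewrite -c_mod (modn_prv G0_admissible) c_mod.
  rewrite /elastic_term -/c cp c2 expr0n /= !mul0r !add0r.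
  have [l0 _] := lam1P _ c3.
  have [-> _ _ _] := angleP G0_admissible i.+2.
  have X0 := X_neq0 G0_admissible i.+2.
  have d0 := delta_gt0 phi_anisotropy G0_admissible i.+2.
  apply: mulf_neq0; first by rewrite gt_eqF.
  apply: mulf_neq0; first by apply: mulf_neq0; [rewrite sqrf_eq0|rewrite gt_eqF].
  by rewrite invr_eq0; apply: mulf_neq0; [rewrite sqrf_eq0 gt_eqF|exact: X0].
have shift_mod k j : exists m, (k + m = j + k * n)%N.
  exists (j + k * n - k)%N; rewrite subnKC //.
  by rewrite (leq_trans (leq_pmulr k n_gt0)) // leq_addl.
(* Two consecutive zeros would propagate around the whole curve. *)
have nocons i : c i = 0 -> c i.+1 != 0.
  move=> c1; apply/eqP => c2; have [j /eqP cj] := exists_curved_edge; apply: cj.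
  have [k ijk] := shift_mod i j.
  rewrite -c_mod -(modnMDl i) addnC -ijk c_mod.
  suff : c (i + k)%N = 0 /\ c (i + k).+1 = 0 by case.
  elim: k {ijk} => [|k [IH1 IH2]]; first by rewrite addn0.
  by rewrite addnS; split=> //; exact: crit_succ.
have noconp i : c i = 0 -> c (prv G0 i) != 0.
  move=> ci; apply/eqP => /nocons /eqP; apply.
  by rewrite -c_mod /prv -addnS prednK // modnDr c_mod.
have hcvgc i : c i != 0 -> cvg (h i t @[t --> +oo]).
  by move=> /lam1P[l0 lc]; exact: hcvg1 l0 lc.
(* If [c i = 0], the cotangents cancel and the length depends only on the heights of the two
   neighbours. These have nonzero transition numbers, so their heights converge. *)
have Lcvg i : cvg (L i t @[t --> +oo]).
  have [ci|ci] := eqVneq (c i) 0; last by apply/cvg_ex; exists (lam1 i); exact: (lam1P i ci).2.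
  have : cvg ((fun t => - (h (prv G0 i) t / X i + h i.+1 t / X i.+1)) t @[t --> +oo]).
    apply: is_cvgN; apply: is_cvgD; apply: is_cvgMl; apply: hcvgc.
      exact: noconp.
    exact: nocons.
  move=> /cvg_ex[x hx]; apply/cvg_ex; exists x; apply: cvg_trans hx.
  apply: near_eq_cvg; apply: filterS near_ge0 => t t0.
  have K0 : K i = 0 := K_of_transition_eq0 phi_anisotropy G0_admissible ci.
  by rewrite L_heights // K0 mul0r addr0.
pose lam i := lim (L i t @[t --> +oo]).
have Llam i : L i t @[t --> +oo] --> lam i by exact: Lcvg.
have lam_lam1 i : c i != 0 -> lam i = lam1 i.
  by move=> /lam1P[_ lc]; exact: cvg_lim lc.
have lam_gt0 i : c i != 0 -> 0 < lam i.
  by move=> ci; rewrite lam_lam1 //; exact: (lam1P i ci).1.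
have lam_ge0 i : 0 <= lam i.
  apply: limr_ge; first exact: Lcvg.
  by apply: filterS near_ge0 => t t0; rewrite ltW // L_gt0.
have lam_eq0 i : lam i = 0 -> c i = 0.
  by move=> li; apply/eqP/negPn/negP => /lam_gt0; rewrite li ltxx.
have lam_mod i : lam (i %% n)%N = lam i.
  apply: cvg_lim => //; apply: cvg_trans (Llam i); apply: near_eq_cvg.
  by apply: filterS near_ge0 => t t0; rewrite L_mod.
have tau_skip i : lam i.+1 = 0 -> tau i = tau i.+2.
  move=> /lam_eq0 ci; have := tau_of_transition_eq0 phi_anisotropy G0_admissible ci.
  by rewrite (tau_prvS G0_admissible).
have lam_prev i : lam i.+1 = 0 -> 0 < lam i.
  move=> li; apply: lam_gt0; apply/eqP => /nocons /eqP; apply; exact: lam_eq0.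
have lam_next i : lam i = 0 -> 0 < lam i.+1.
  by move=> /lam_eq0 ci; apply: lam_gt0; exact: nocons.
(* Otherwise positive and zero limit lengths alternate from a curved edge on, and all positive ones
   have the same direction. Passing to the limit in [sum_edges] would make the total length zero. *)
have [i [li lSi]] : exists i, 0 < lam i /\ 0 < lam i.+1.
  apply: contrapT => none.
  have [i0 /lam_gt0 li0] := exists_curved_edge.
  have along k : lam (i0 + k)%N = 0 \/ tau (i0 + k)%N = tau i0.
    suff : 0 < lam (i0 + k)%N /\ tau (i0 + k)%N = tau i0 \/
        lam (i0 + k)%N = 0 /\ tau (i0 + k).+1 = tau i0.
      by case=> -[]; [right|left].
    elim: k => [|k [[lk tk]|[lk tk]]]; first by left; rewrite addn0.
      right; rewrite addnS.
      have l0 : lam (i0 + k).+1 = 0.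
        apply/eqP/negPn/negP => ne; apply: none; exists (i0 + k)%N; split=> //.
        by rewrite lt_def ne lam_ge0.
      by split=> //; rewrite -tau_skip.
    by left; rewrite addnS; split=> //; exact: lam_next.
  have dotE j : lam j * dot (tau i0) (tau j) = lam j.
    have [k ijk] := shift_mod i0 j.
    have -> : tau j = tau (i0 + k)%N by rewrite ijk -[RHS]tau_mod addnC modnMDl tau_mod.
    have -> : lam j = lam (i0 + k)%N by rewrite ijk -[RHS]lam_mod addnC modnMDl lam_mod.
    by case: (along k) => ->; rewrite ?mul0r // (tau_unit G0_admissible) mulr1.
  have S0 : \sum_(j < n) lam j = 0.
    under eq_bigr do rewrite -dotE.
    have cv : \sum_(j < n) L j t * dot (tau i0) (tau j) @[t --> +oo] -->
        \sum_(j < n) lam j * dot (tau i0) (tau j).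
      apply: cvg_big => [|j _]; first exact: add_continuous.
      by apply: cvgM; [exact: Llam|exact: cvg_cst].
    have c0 : \sum_(j < n) L j t * dot (tau i0) (tau j) @[t --> +oo] --> (0 : R).
      apply: (@cvg_trans _ ((fun=> 0 : R) t @[t --> +oo])); last exact: cvg_cst.
      apply: near_eq_cvg; apply: filterS near_ge0 => t t0.
      have := congr1 (dot (tau i0)) (sum_edges t0).
      rewrite dot_sumr dot0r => E; symmetry; rewrite -[RHS]/(0 : R) -[RHS]E.
      by apply: eq_bigr => j _; rewrite dotZr.
    exact: (cvg_unique _ cv c0).
  move/eqP: S0; apply/negP; rewrite gt_eqF // (bigD1 (o i0)) //= lam_mod.
  by rewrite ltr_pwDl // sumr_ge0.
(* The vertex between two non-parallel segments is recovered from their convergent heights by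
   Cramer's rule; adding edges then gives the other vertices. *)
have cvg_v0 : cvg (v i.+1 t @[t --> +oo]).
  pose x := cross (tau i) (tau i.+1).
  have X0 : x != 0 := cross_tauS_neq0 G0_admissible i.
  have /cvg_ex[p hp] := hcvg1 _ _ li (Llam i).
  have /cvg_ex[q hq] := hcvg1 _ _ lSi (Llam i.+1).
  apply/cvg_ex; exists (x^-1 *: (p *: tau i.+1 - q *: tau i)).
  apply: (@cvg_trans _ ((fun t => x^-1 *: (h i t *: tau i.+1 - h i.+1 t *: tau i)) t @[t --> +oo])).
    apply: near_eq_cvg; apply: filterS near_ge0 => t t0.
    rewrite -(hS i t0) /h; apply: (scalerI X0); rewrite scalerA divff // scale1r.
    by rewrite -cross_cramer.
  apply: cvgZ; first exact: cvg_cst.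
  by apply: cvgB; apply: cvgZ => //; exact: cvg_cst.
have cvg_vk k : cvg (v (i.+1 + k) t @[t --> +oo]).
  elim: k => [|k /cvg_ex[x IH]]; first by rewrite addn0.
  rewrite addnS; apply/cvg_ex; exists (x + lam (i.+1 + k)%N *: tau (i.+1 + k)%N).
  apply: (@cvg_trans _ ((fun t => v (i.+1 + k)%N t +
      L (i.+1 + k)%N t *: tau (i.+1 + k)%N) t @[t --> +oo])).
    by apply: near_eq_cvg; apply: filterS near_ge0 => t t0; rewrite vS.
  apply: cvgD => //; apply: cvgZ; [exact: Llam|exact: cvg_cst].
have v_eq j k : (j %% n = k %% n)%N -> \forall t \near +oo, v j t = v k t.
  by move=> jk; apply: filterS near_ge0 => t t0; rewrite -v_mod // jk v_mod.
have cvg_v j : cvg (v j t @[t --> +oo]).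
  have [k ijk] := shift_mod i.+1 j.
  have /cvg_ex[x hx] := cvg_vk k; apply/cvg_ex; exists x; apply: cvg_trans hx.
  by apply: near_eq_cvg; apply: v_eq; rewrite ijk addnC modnMDl.
pose V j := lim (v j t @[t --> +oo]).
have vV j : v j t @[t --> +oo] --> V j by exact: cvg_v.
have V_eq j k : (j %% n = k %% n)%N -> V j = V k.
  move=> jk; apply: (cvg_lim (@norm_hausdorff _ _)); apply: cvg_trans (vV k).
  by apply: near_eq_cvg; exact: v_eq.
exists V, lam; split=> //; last first.
  by move=> j; rewrite (@eq_elastic_term R phi G0 lam lam1 j lam_lam1).
split.
- split=> j; first by apply: V_eq; rewrite modnDr.
    by rewrite -tau_mod modnDr tau_mod.
  by rewrite -lam_mod modnDr lam_mod.
- move=> j; apply: (cvg_lim (@norm_hausdorff _ _)).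
  apply: (@cvg_trans _ ((fun t => v j t + L j t *: tau j) t @[t --> +oo])).
    by apply: near_eq_cvg; apply: filterS near_ge0 => t t0; rewrite vS.
  apply: cvgD => //; apply: cvgZ; [exact: Llam|exact: cvg_cst].
- move=> j; split; first exact: lam_ge0.
  by rewrite -dotxx_eq0 (tau_unit G0_admissible) oner_eq0.
- by move=> j; exists j.
- by move=> j lj; split; [exact: lam_prev|exact: tau_skip].
Qed.

End flow_convergence.

(** * The limit curve *)

Lemma cvg_pinfty_translate (R : realType) (U : topologicalType) (f : R -> U) (t0 : R) (a : U) :
  f (t0 + s) @[s --> +oo] --> a -> f t @[t --> +oo] --> a.
Proof.
move=> fa B /fa[M [_ HM]]; exists (M + t0); split; first exact: num_real.
move=> t Mt; have /= := HM (t - t0); rewrite ltrBrDr => /(_ Mt).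
by rewrite [t0 + _]addrC subrK.
Qed.

(** Consecutive directions of [P] are consecutive directions of [G0], so non-parallelism, facets and
    common vertices are inherited pair by pair. *)
Lemma admissible_of_chain (R : realType) (phi : 'rV[R]_2 -> R) (G0 P : curve R)
    (tau : nat -> 'rV[R]_2) (l : nat -> R) :
  admissible phi G0 -> (0 < size P)%N ->
  (forall i, vtx P i.+1 = vtx P i + l i *: tau i) -> (forall i, 0 < l i) ->
  (forall i, exists k, tau i = tangent (seg G0 k) /\ tau i.+1 = tangent (seg G0 k.+1)) ->
  admissible phi P.
Proof.
move=> G0_admissible P_gt0 vP l_gt0 QP.
have unit i : dot (tau i) (tau i) = 1.
  by have [k [-> _]] := QP i; exact: (tau_unit G0_admissible).
have tangentP i : tangent (seg P i) = tau i by exact: tangent_unique (vP i).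
have normalP i : exists k, normal (seg P i) = normal (seg G0 k) /\
    normal (seg P i.+1) = normal (seg G0 k.+1).
  by have [k [e e']] := QP i; exists k; rewrite /normal !tangentP e e'.
split.
- split=> // i _; split.
    move=> /degenerateP; rewrite (seglen_tangent_unique (unit i) (ltW (l_gt0 i)) (vP i)).
    by apply/eqP; rewrite gt_eqF.
  rewrite /parallel_seg [(seg P i.+1).2]vP [vtx P i.+1 + _]addrC addrK dotZr dot_normal.
  rewrite tangentP; have [k [-> ->]] := QP i; apply/eqP.
  by apply: mulf_neq0; [rewrite gt_eqF|exact: (cross_tauS_neq0 G0_admissible)].
- move=> i _; have [k [e _]] := normalP i; exists (facet_of phi (seg G0 k)).
  by rewrite e (normal_facet_of G0_admissible); split=> //; exact: (facet_ofP G0_admissible k).1.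
- move=> i _; have [k [e e']] := normalP (prv P i).
  have {}e' : normal (seg P i) = normal (seg G0 k.+1).
    rewrite -e'; congr normal; rewrite -[LHS]seg_mod -[RHS]seg_mod /prv -addnS prednK //.
    by rewrite modnDr.
  rewrite (eq_normal_facet_of phi e) (eq_normal_facet_of phi e').
  have := common_vertex_prv G0_admissible k.+1.
  by rewrite seg_prvS // (admissible_size_gt0 G0_admissible).
Qed.

Theorem theorem7p3 (R : realType) (phi : 'rV[R]_2 -> R) (alpha : R)
    (G : R -> curve R) (T : R) (n : nat)
    (phi_anisotropy : anisotropy phi) (phi_crystalline : crystalline phi)
    (alpha_gt0 : 0 < alpha)
    (G_flow : elastic_flow_restarts phi alpha G)
    (T_gt0 : 0 < T)
    (size_G : forall t : R, T <= t -> size (G t) = n)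
    (inf_gt0 : forall m : R, 0 < m ->
       0 < inf [set min_seglen (G t) | t in `[T, T + m]])
    (liminf_eq0 :
       limf_einf (fun t : R => (min_seglen (G t))%:E) (pinfty_nbhs R) = 0%E) :
  exists Ginf : curve R,
    [/\ admissible phi Ginf,
        kuratowski_cvg (pinfty_nbhs R) (fun t => curve_set (G t))
          (curve_set Ginf)
      & exists P : curve R,
        [/\ size P = n,
            collapse P Ginf,
            curve_set Ginf = \bigcup_(i in `I_n) seg_set (seg P i)
          & forall i, (i < n)%N ->
            [/\ kuratowski_cvg (pinfty_nbhs R)
                  (fun t => seg_set (seg (G t) i)) (seg_set (seg P i)),
                seglen (seg (G t) i) @[t --> +oo] --> seglen (seg P i),
                degenerate (seg P i) -> transition (G T) i = 0
              & ~ degenerate (seg P i) ->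
                transition (G T) i * facet_len phi (G T) i
                + alpha * elastic_term phi (G T) (fun j => seglen (seg P j)) i
                = 0]]].
Proof.
have [t0 [t0_ge0 t0T G0_admissible flow]] :=
  elastic_flow_after_restarts G_flow T_gt0 size_G.
have n_gt0 := admissible_size_gt0 G0_admissible.
have [V [lam [chain vV lV lam0 crit]]] :=
  flow_limit phi_anisotropy G0_admissible alpha_gt0 flow.
(* The limit equations refer to [G t0]; since [G T] is parallel to it, they have the same transition
   numbers, facets and angles. *)
have parT : parallel_curve (G t0) (G T).
  have [_ par _] := flow; rewrite -(subrK t0 T) addrC.
  by apply: par; [rewrite subr_ge0|exact: ltry].
have nE : size (G t0) = n by rewrite -(size_G _ (lexx T)); case: parT.
rewrite nE in n_gt0 chain.
have normalT := parallel_curve_normal (admissible_size_gt0 G0_admissible) parT.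
have sizeT : size (G T) = size (G t0) by case: parT.
have [Ginf [tau' [l' [PG Ginf_gt0 vG l'_gt0 QG]]]] := closed_chain_collapse n_gt0 chain.
have [[Vn _ _] VS lam_ge0 _ _] := chain.
pose P := mkseq V n.
have sP : size P = n by rewrite size_mkseq.
have vtxP i : vtx P i = V i.
  by rewrite /vtx sP nth_mkseq ?ltn_mod // (periodic_mod Vn).
have segP i : seg P i = (V i, V i.+1) by rewrite /seg !vtxP.
have lenP i : seglen (seg P i) = lam i.
  rewrite segP; apply: seglen_tangent_unique (VS i); last exact: (lam_ge0 i).1.
  exact: tau_unit G0_admissible i.
have vcvg i : vtx (G t) i @[t --> +oo] --> V i := cvg_pinfty_translate (vV i).
have curveE : curve_set Ginf = \bigcup_(i in `I_n) seg_set (seg P i).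
  by rewrite -(curve_set_collapse PG Ginf_gt0) /curve_set sP.
exists Ginf; split.
- exact: admissible_of_chain G0_admissible Ginf_gt0 vG l'_gt0 QG.
- rewrite curveE; under eq_bigcupr do rewrite segP.
  apply: (@kuratowski_cvg_near _ _ _ _ (fun t => \bigcup_(i in `I_n) seg_set (seg (G t) i))).
    exists T; split; first exact: num_real.
    by move=> t /ltW/size_G; rewrite /curve_set => ->.
  apply: kuratowski_cvg_bigcup_seg => i _; exact: vcvg.
exists P; split=> // i i_n; split.
- by rewrite segP; exact: kuratowski_cvg_seg.
- by rewrite lenP; exact: (cvg_pinfty_translate (lV i)).
- move=> /degenerateP; rewrite lenP => /lam0.
  by rewrite (eq_normal_transition sizeT normalT).
- move=> _; rewrite (eq_normal_transition sizeT normalT) (eq_normal_facet_len _ normalT).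
  rewrite (eq_normal_elastic_term phi sizeT normalT).
  by rewrite (_ : (fun j => _) = lam) ?crit //; apply/funext => j; exact: lenP.
Qed.
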